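(* Let $F\in\mathcal{L}_1(S)$. If $\mathrm{Int}(\mathrm{Rot}_{\mathbb{R}}(F))\cap\mathbb{Z}\neq\emptyset$, then $\mathrm{Per}(F)$ is equal to either $\mathbb{N}$, or $\mathbb{N}\setminus\{1\}$, or $\mathbb{N}\setminus\{2\}$. Moreover, there exist maps $F_0,F_1,F_2\in\mathcal{L}_1(S)$ with $0\in\mathrm{Int}(\mathrm{Rot}_{\mathbb{R}}(F_i))$ for $i=0,1,2$ such that $\mathrm{Per}(F_0)=\mathbb{N}$, $\mathrm{Per}(F_1)=\mathbb{N}\setminus\{1\}$ and $\mathrm{Per}(F_2)=\mathbb{N}\setminus\{2\}$.
   Context: $\mathbb{N}=\{1,2,3,\dots\}$. $S=\mathbb{R}\cup B\subset\mathbb{C}$, where $B=\{z\in\mathbb{C}:\mathrm{Re}(z)\in\mathbb{Z},\ \mathrm{Im}(z)\in[0,1]\}$ and $\mathbb{R}$ is the real axis. $\mathcal{L}_1(S)$ is the set of continuous maps $F:S\to S$ with $F(z+1)=F(z)+1$ for all $z\in S$. A point $z\in S$ is periodic (mod 1) for $F$ if $F^n(z)\in z+\mathbb{Z}$ for some $n\in\mathbb{N}$; the least such $n$ is its period (mod 1). $\mathrm{Per}(F)$ is the set of periods (mod 1) of all periodic (mod 1) points of $F$. The rotation number of $z\in S$ is $\rho_F(z)=\lim_{n\to\infty}\frac{\mathrm{Re}(F^n(z))-\mathrm{Re}(z)}{n}$ when the limit exists; $\mathrm{Rot}_{\mathbb{R}}(F)=\{\rho_F(z):z\in\mathbb{R},\text{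 the limit exists}\}$, which is known to be a non-empty compact interval of $\mathbb{R}$. $\mathrm{Int}$ denotes interior in $\mathbb{R}$. *)

(* Defs.v *)
(* Stdlib reals with Coquelicot. *)
From Stdlib Require Import Reals ZArith.
From Coquelicot Require Import Coquelicot.

Definition branches (z : C) : Prop :=
  (exists k : Z, Re z = IZR k) /\ (0 <= Im z <= 1)%R.

Definition real_axis (z : C) : Prop := Im z = 0%R.

Definition Sspace (z : C) : Prop := real_axis z \/ branches z.

(* A map S -> S is represented by a total function on C whose values outside
   S are irrelevant, since S is invariant and every orbit considered starts
   in S.  [continuous_on] is continuity for the subspace topology of S. *)
Definition L1 (F : C -> C) : Prop :=
  (forall z, Sspace z -> Sspace (F z)) /\
  continuous_on Sspace F /\
  (forall z, Sspace z -> F (z + 1)%C = (F z + 1)%C).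

Definition returns_mod1 (F : C -> C) (z : C) (n : nat) : Prop :=
  exists k : Z, Nat.iter n F z = (z + RtoC (IZR k))%C.

Definition has_period_mod1 (F : C -> C) (z : C) (n : nat) : Prop :=
  (1 <= n)%nat /\ returns_mod1 F z n /\
  (forall m : nat, (1 <= m)%nat -> returns_mod1 F z m -> (n <= m)%nat).

Definition Per (F : C -> C) (n : nat) : Prop :=
  exists z : C, Sspace z /\ has_period_mod1 F z n.

(* The term n = 0 of the sequence is a division by zero, irrelevant to the
   limit. *)
Definition is_rotation_number (F : C -> C) (z : C) (rho : R) : Prop :=
  is_lim_seq (fun n : nat => ((Re (Nat.iter n F z) - Re z) / INR n)%R)
             (Finite rho).

Definition RotR (F : C -> C) (rho : R) : Prop :=
  exists z : C, real_axis z /\ is_rotation_number F z rho.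

(* The set of positive integers. *)
Definition posnat (n : nat) : Prop := (1 <= n)%nat.

Definition posnat_minus (k n : nat) : Prop := posnat n /\ n <> k.

Definition same_set {T : Type} (A A' : T -> Prop) : Prop :=
  forall x, A x <-> A' x.

(* Main.v *)
Require Import Defs.
From Stdlib Require Import Reals ZArith Lra Lia Classical IndefiniteDescription.
From Coquelicot Require Import Coquelicot.

(** Integer translations do not change periods mod 1, so the integer interior
to the rotation interval may be taken to be 0.  All that is used of this
hypothesis is one real point whose orbit goes to -oo and one whose orbit goes
to +oo.  A map F of the class is read through four real functions: the axis
point x goes to (g x, Y x), the point of height y over 0 goes to (U y, h y).
When Y x or h y is positive the image is inside a branch, so g x or U y is an
integer; the point is then said to climb.

Call z a lower barrier if g maps [z,+oo) into itself, and define upper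
barriers symmetrically.

No barrier at all.  Extremal inverse branches of g produce a < b < c with
g a <= b, c <= g b and g c <= a ([triple_of_no_barrier]), the pattern that
forces cycles of every length for an interval map ([li_yorke]).  The circle
map g forgets the branches, but its cycles survive in F
([per_of_circle_cycle]): a cycle of g that F leaves passes through an integer
whose first climb occurs after exactly n steps, and then F has period n
inside the branch ([per_of_first_climb]).

A lower barrier (an upper one alone is the mirror image).  The orbit going to
-oo has to use the branches.  Let [0,top] be the heights reached from the
axis and [0,hull] the h-stable heights they generate.  If some height in
(top,hull] is sent back to the axis, either h, or F retracted to the arc
formed by a branch and a piece of axis on one side of it, has a triple as
above and all periods occur ([periods_of_high_zero]).  Otherwise U takes on
[0,top] all its values on [0,hull], so the single step from [0,top] to the
axis already passes every barrier.  Periodic points are then made from loops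
that leave the branch, spend j - 1 steps in real intervals, and climb back
over the whole of [0,top]; visiting the branch exactly once makes the period
exactly j + 1 ([lap_pull], [lap_close]).  With both barriers every length
n >= 2 occurs ([periods_both_barriers]).  With a lower barrier only, either
the branch covers a full turn of the circle and every n >= 2 occurs
([periods_of_full_turn]), or it covers an interval next to a fixed point of g
and every n >= 3 occurs, along with period 1 ([periods_of_repelling_side]), or
g alone has a triple ([periods_lower_only]).  In every case all n >= 3 are
periods, and so is 1 or 2.

Conversely the three examples are piecewise affine.  By the first half it is
enough to see that F0 has periods 1 and 2, that F1 has no fixed point and that
F2 has no orbit of period 2.  Their rotation intervals contain a neighbourhood
of 0 because some iterate stretches an interval of length less than 1 over
both its translates by -1 and by 1 ([interior_of_legs]). *)

Open Scope R_scope.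

(** * Intermediate values and coverings of intervals *)

Lemma sign_stable_lt (f : R -> R) (x c : R) :
  continuity f -> f x < c -> exists d, 0 < d /\ forall t, Rabs (t - x) < d -> f t < c.
Proof.
  intros Hf Hx. destruct (Hf x (c - f x)) as [d [Hd H]]; [lra|].
  exists d; split; [exact Hd|]. intros t Ht.
  destruct (Req_dec t x) as [->|Hne]; [lra|].
  assert (Hq : Rabs (f t - f x) < c - f x).
  { apply (H t). split; [|exact Ht]. split; [exact I|]. congruence. }
  apply Rabs_def2 in Hq. lra.
Qed.

Lemma sign_stable_gt (f : R -> R) (x c : R) :
  continuity f -> c < f x -> exists d, 0 < d /\ forall t, Rabs (t - x) < d -> c < f t.
Proof.
  intros Hf Hx.
  destruct (sign_stable_lt (fun t => - f t) x (- c)) as [d [Hd H]].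
  - apply continuity_opp, Hf.
  - lra.
  - exists d; split; [exact Hd|]. intros t Ht. specialize (H t Ht). lra.
Qed.

Lemma glb_exists (E : R -> Prop) (m0 x0 : R) :
  E x0 -> (forall x, E x -> m0 <= x) ->
  exists m, (forall x, E x -> m <= x) /\ (forall eps, 0 < eps -> exists x, E x /\ x < m + eps).
Proof.
  intros Hx0 Hlow.
  destruct (completeness (fun y => E (- y))) as [s [Hs1 Hs2]].
  - exists (- m0). intros y Hy. specialize (Hlow _ Hy). lra.
  - exists (- x0). rewrite Ropp_involutive. exact Hx0.
  - exists (- s). split.
    + intros x Hx. assert (H : - x <= s) by (apply Hs1; rewrite Ropp_involutive; exact Hx). lra.
    + intros eps Heps. apply NNPP. intros Hn.
      assert (H : s <= s - eps); [|lra]. apply Hs2. intros y Hy.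
      apply Rnot_lt_le. intros Hlt. apply Hn. exists (- y). split; [exact Hy|lra].
Qed.

Lemma first_ge (f : R -> R) (a b c : R) :
  continuity f -> a <= b -> f a <= c -> c <= f b ->
  exists x, a <= x <= b /\ f x = c /\ forall t, a <= t < x -> f t < c.
Proof.
  intros Hf Hab Ha Hb.
  destruct (glb_exists (fun t => a <= t <= b /\ c <= f t) a b) as [m [Hm1 Hm2]].
  - split; lra.
  - intros x [Hx _]; lra.
  - assert (Ham : a <= m).
    { apply Rnot_lt_le. intros Hlt. destruct (Hm2 (a - m)) as [x [[Hx _] Hx']]; lra. }
    assert (Hmb : m <= b) by (apply Hm1; split; lra).
    assert (Hge : c <= f m).
    { apply Rnot_lt_le. intros Hlt.
      destruct (sign_stable_lt f m c Hf Hlt) as [d [Hd H]].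
      destruct (Hm2 d Hd) as [x [[Hx Hfx] Hx']].
      assert (m <= x) by (apply Hm1; split; assumption).
      specialize (H x). rewrite Rabs_right in H; lra. }
    assert (Hbelow : forall t, a <= t < m -> f t < c).
    { intros t Ht. apply Rnot_le_lt. intros Hc.
      assert (m <= t) by (apply Hm1; split; [lra|exact Hc]). lra. }
    assert (Hle : f m <= c).
    { destruct (Req_dec a m) as [->|Hne]; [exact Ha|].
      apply Rnot_lt_le. intros Hgt.
      destruct (sign_stable_gt f m c Hf Hgt) as [d [Hd H]].
      pose (t := Rmax a (m - d / 2)).
      assert (Ht : a <= t < m /\ m - t < d).
      { unfold t, Rmax. destruct (Rle_dec a (m - d/2)); lra. }
      specialize (Hbelow t (proj1 Ht)).
      assert (c < f t); [|lra]. apply H. rewrite Rabs_left1; lra. }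
    exists m. split; [lra|]. split; [lra|exact Hbelow].
Qed.

Lemma continuity_flip (f : R -> R) : continuity f -> continuity (fun t => f (- t)).
Proof.
  intros Hf. apply (continuity_comp (fun t => - t) f); [|exact Hf].
  apply continuity_opp. apply derivable_continuous, derivable_id.
Qed.

Lemma last_le (f : R -> R) (a b c : R) :
  continuity f -> a <= b -> f a <= c -> c <= f b ->
  exists x, a <= x <= b /\ f x = c /\ forall t, x < t <= b -> c < f t.
Proof.
  intros Hf Hab Ha Hb.
  destruct (first_ge (fun t => - f (- t)) (- b) (- a) (- c)) as [x [Hx [Hfx H]]].
  - apply continuity_opp, continuity_flip, Hf.
  - lra.
  - rewrite Ropp_involutive. lra.
  - rewrite Ropp_involutive. lra.
  - exists (- x). split; [lra|]. split; [lra|]. intros t Ht.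
    specialize (H (- t)). rewrite Ropp_involutive in H. lra.
Qed.

Definition covers (f : R -> R) (a b c d : R) : Prop :=
  (f a <= c /\ d <= f b) \/ (f b <= c /\ d <= f a).

Lemma ivt_between (f : R -> R) (a b c : R) :
  continuity f -> a <= b -> covers f a b c c -> exists x, a <= x <= b /\ f x = c.
Proof.
  intros Hf Hab [[H1 H2]|[H1 H2]].
  - destruct (first_ge f a b c Hf Hab H1 H2) as [x [Hx [Hfx _]]]. exists x; auto.
  - destruct (first_ge (fun t => - f t) a b (- c)) as [x [Hx [Hfx _]]];
      [apply continuity_opp, Hf| lra | lra | lra |].
    exists x. split; [exact Hx|lra].
Qed.

Definition onto_ends (f : R -> R) (a b c d : R) : Prop :=
  (f a = c /\ f b = d) \/ (f a = d /\ f b = c).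

(** Take the first point of [a,b] that reaches d, then the last point before it
at c (for a covering that preserves the orientation). *)
Lemma cover_sub (f : R -> R) (a b c d : R) :
  continuity f -> a <= b -> c < d -> covers f a b c d ->
  exists a' b', a <= a' /\ a' < b' /\ b' <= b /\ onto_ends f a' b' c d /\
    forall t, a' < t < b' -> c < f t < d.
Proof.
  assert (main : forall (f : R -> R) c d, continuity f -> a <= b -> c < d -> f a <= c -> d <= f b ->
    exists a' b', a <= a' /\ a' < b' /\ b' <= b /\ f a' = c /\ f b' = d /\
    forall t, a' < t < b' -> c < f t < d).
  { clear f c d. intros f c d Hf Hab Hcd Ha Hb.
    destruct (first_ge f a b d) as [b' [Hb' [Hfb' Hlt]]]; [exact Hf|lra|lra|lra|].
    destruct (last_le f a b' c) as [a' [Ha' [Hfa' Hgt]]]; [exact Hf|lra|lra|lra|].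
    exists a', b'. assert (a' <> b') by (intros ->; lra).
    repeat split; try lra.
    - apply Hgt; lra.
    - apply Hlt; lra. }
  intros Hf Hab Hcd [[H1 H2]|[H1 H2]].
  - destruct (main f c d Hf Hab Hcd H1 H2) as (a' & b' & ? & ? & ? & ? & ? & ?).
    exists a', b'. repeat split; try assumption; [left; split; assumption| |]; apply H6; assumption.
  - destruct (main (fun t => - f t) (- d) (- c)) as (a' & b' & ? & ? & ? & ? & ? & Hin); try lra.
    + apply continuity_opp, Hf.
    + exists a', b'. split; [lra|]. split; [lra|]. split; [lra|]. split; [right; lra|].
      intros t Ht. specialize (Hin t Ht). lra.
Qed.

Lemma onto_ends_range (f : R -> R) (a b c d : R) :
  c < d -> onto_ends f a b c d -> (forall t, a < t < b -> c < f t < d) ->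
  forall t, a <= t <= b -> c <= f t <= d.
Proof.
  intros Hcd He Hin t Ht.
  destruct (Req_dec t a) as [->|Ha]; [destruct He; lra|].
  destruct (Req_dec t b) as [->|Hb]; [destruct He; lra|].
  specialize (Hin t). lra.
Qed.

Lemma continuity_iter (f : R -> R) (n : nat) :
  continuity f -> continuity (fun x => Nat.iter n f x).
Proof.
  intros Hf. induction n as [|n IH]; simpl.
  - apply derivable_continuous, derivable_id.
  - apply (continuity_comp (fun x => Nat.iter n f x) f); assumption.
Qed.

Lemma fixed_of_ends (f : R -> R) (a b c d : R) :
  continuity f -> a <= b -> c <= a -> b <= d -> onto_ends f a b c d ->
  exists x, a <= x <= b /\ f x = x.
Proof.
  intros Hf Hab Hc Hd He.
  destruct (ivt_between (fun t => f t - t) a b 0) as [x [Hx Hfx]].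
  - apply continuity_minus; [exact Hf|apply derivable_continuous, derivable_id].
  - exact Hab.
  - destruct He as [[H1 H2]|[H1 H2]]; [left|right]; lra.
  - exists x. split; [exact Hx|lra].
Qed.

Lemma iter_succ_r {T : Type} (f : T -> T) (n : nat) (x : T) :
  Nat.iter (S n) f x = Nat.iter n f (f x).
Proof. induction n as [|n IH]; simpl; [reflexivity|]. simpl in IH. now rewrite IH. Qed.

Lemma iter_pred {T : Type} (f : T -> T) (n : nat) (x : T) :
  (1 <= n)%nat -> Nat.iter n f x = f (Nat.iter (n - 1) f x).
Proof. intros Hn. destruct n as [|n]; [lia|]. simpl. now rewrite Nat.sub_0_r. Qed.

Lemma iter_add {T : Type} (f : T -> T) (m n : nat) (x : T) :
  Nat.iter (m + n) f x = Nat.iter m f (Nat.iter n f x).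
Proof. induction m as [|m IH]; simpl; congruence. Qed.

(** * Cycles of interval maps *)

(** Since f maps [b,c] over [a,c], the interval [a,b] can be pulled back n - 1
times inside [b,c], and once more inside [a,b], which f maps over [b,c].  The
n-th iterate stretches the resulting piece of [a,b] over [a,b], so it has a
fixed point there.  The orbit meets [a,b) once, which makes n its exact
length. *)
Lemma li_yorke (f : R -> R) (a b c : R) (n : nat) :
  continuity f -> a < b -> b < c -> f a <= b -> c <= f b -> f c <= a -> (2 <= n)%nat ->
  exists x, a <= x < b /\ Nat.iter n f x = x /\
    forall j, (1 <= j < n)%nat -> b <= Nat.iter j f x <= c.
Proof.
  intros Hf Hab Hbc Ha Hb Hc Hn.
  assert (chain : forall j, (1 <= j)%nat -> exists p q, b <= p /\ p < q /\ q <= c /\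
     onto_ends (fun x => Nat.iter j f x) p q a b /\
     forall t, p <= t <= q -> forall i, (i < j)%nat -> b <= Nat.iter i f t <= c).
  { intros j Hj. induction Hj as [|j Hj IH].
    - destruct (cover_sub f b c a b Hf) as (p & q & H1 & H2 & H3 & H4 & H5); [lra|lra|right; lra|].
      exists p, q. repeat (split; [assumption|]). intros t Ht i Hi.
      replace i with 0%nat by lia. simpl. lra.
    - destruct IH as (p & q & H1 & H2 & H3 & H4 & H5).
      destruct (cover_sub f b c p q Hf) as (p' & q' & H1' & H2' & H3' & H4' & H5'); [lra|lra|right; lra|].
      exists p', q'. repeat (split; [assumption|]). split.
      + unfold onto_ends. rewrite !iter_succ_r.
        destruct H4' as [[-> ->]|[-> ->]]; [exact H4|].
        destruct H4; [right|left]; tauto.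
      + intros t Ht i Hi. destruct i as [|i]; [simpl; lra|].
        rewrite iter_succ_r. apply H5; [|lia].
        apply (onto_ends_range f p' q' p q H2 H4' H5' t Ht). }
  destruct (chain (n - 1)%nat) as (p & q & H1 & H2 & H3 & H4 & H5); [lia|].
  destruct (cover_sub f a b p q Hf) as (p' & q' & H1' & H2' & H3' & H4' & H5'); [lra|lra|left; lra|].
  destruct (fixed_of_ends (fun x => Nat.iter n f x) p' q' a b) as [x [Hx Hfx]].
  - apply continuity_iter, Hf.
  - lra.
  - lra.
  - lra.
  - unfold onto_ends. replace n with (S (n - 1)) by lia. rewrite !iter_succ_r.
    destruct H4' as [[-> ->]|[-> ->]]; [exact H4|].
    destruct H4; [right|left]; tauto.
  - assert (Hloc : forall j, (1 <= j < n)%nat -> b <= Nat.iter j f x <= c).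
    { intros j Hj. destruct j as [|j]; [lia|]. rewrite iter_succ_r.
      apply H5; [|lia]. apply (onto_ends_range f p' q' p q H2 H4' H5' x Hx). }
    exists x. split; [|split; [exact Hfx|exact Hloc]]. split; [lra|].
    (* x = b would give f (f b) <= a < b, which no point of the orbit allows *)
    apply Rnot_le_lt. intros Hxb. assert (x = b) as -> by lra.
    assert (Hfb : f b = c) by (specialize (Hloc 1%nat); simpl in Hloc; assert (b <= f b <= c) by (apply Hloc; lia); lra).
    destruct (Nat.eq_dec n 2) as [->|Hn2].
    + simpl in Hfx. rewrite Hfb in Hfx. lra.
    + specialize (Hloc 2%nat). simpl in Hloc. rewrite Hfb in Hloc.
      assert (b <= f c <= c) by (apply Hloc; lia). lra.
Qed.

Definition exact_cycle (f : R -> R) (n : nat) (x : R) : Prop :=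
  Nat.iter n f x = x /\ forall j, (1 <= j < n)%nat -> Nat.iter j f x <> x.

Lemma li_yorke_exact (f : R -> R) (a b c : R) (n : nat) :
  continuity f -> a < b -> b < c -> f a <= b -> c <= f b -> f c <= a -> (1 <= n)%nat ->
  exists x, exact_cycle f n x /\ forall j, (j < n)%nat -> a <= Nat.iter j f x <= c.
Proof.
  intros Hf Hab Hbc Ha Hb Hc Hn.
  destruct (Nat.eq_dec n 1) as [->|Hn1].
  - destruct (ivt_between (fun t => f t - t) b c 0) as [x [Hx Hfx]].
    + apply continuity_minus; [exact Hf|apply derivable_continuous, derivable_id].
    + lra.
    + right; lra.
    + exists x. split; [split; [simpl; lra|intros j Hj; lia]|].
      intros j Hj. replace j with 0%nat by lia. simpl. lra.
  - destruct (li_yorke f a b c n) as (x & Hx & Hfix & Hloc); try assumption; [lia|].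
    exists x. split; [split; [exact Hfix|]|].
    + intros j Hj Hj'. specialize (Hloc j Hj). lra.
    + intros j Hj. destruct j as [|j]; [simpl; lra|]. specialize (Hloc (S j)).
      assert (b <= Nat.iter (S j) f x <= c) by (apply Hloc; lia). lra.
Qed.

Lemma iter_conj_opp (f : R -> R) (n : nat) (x : R) :
  Nat.iter n (fun t => - f (- t)) x = - Nat.iter n f (- x).
Proof. induction n as [|n IH]; simpl; [lra|]. rewrite IH. now rewrite Ropp_involutive. Qed.

Lemma li_yorke_exact_opp (f : R -> R) (a b c : R) (n : nat) :
  continuity f -> a < b -> b < c -> c <= f a -> f b <= a -> b <= f c -> (1 <= n)%nat ->
  exists x, exact_cycle f n x /\ forall j, (j < n)%nat -> a <= Nat.iter j f x <= c.
Proof.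
  intros Hf Hab Hbc Ha Hb Hc Hn.
  destruct (li_yorke_exact (fun t => - f (- t)) (- c) (- b) (- a) n) as [x [[H1 H2] H3]];
    try (rewrite ?Ropp_involutive; lra); try assumption.
  - apply continuity_opp, continuity_flip, Hf.
  - exists (- x). split; [split|].
    + rewrite iter_conj_opp in H1. lra.
    + intros j Hj He. apply (H2 j Hj). rewrite iter_conj_opp. lra.
    + intros j Hj. specialize (H3 j Hj). rewrite iter_conj_opp in H3. lra.
Qed.

(** * Integers, translations and the space *)

Definition is_int (x : R) : Prop := exists k : Z, x = IZR k.

Lemma not_int_between (k : Z) (x : R) : IZR k < x < IZR k + 1 -> ~ is_int x.
Proof.
  intros [H1 H2] [m ->]. apply lt_IZR in H1.
  replace (IZR k + 1) with (IZR (k + 1)) in H2 by (rewrite plus_IZR; lra).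
  apply lt_IZR in H2. lia.
Qed.

(** Between two different values, one of them an integer, there is a
non-integer. *)
Lemma int_valued_const (f : R -> R) (a b : R) :
  continuity f -> a < b -> (forall t, a < t < b -> is_int (f t)) ->
  exists k : Z, forall t, a <= t <= b -> f t = IZR k.
Proof.
  intros Hf Hab Hint. set (m := (a + b) / 2).
  destruct (Hint m) as [k Hk]; [unfold m; lra|].
  exists k. intros t Ht. apply NNPP. intros Hne.
  assert (Hm : a < m < b) by (unfold m; lra).
  assert (Hval : forall c, f t < c < f m \/ f m < c < f t -> is_int c).
  { intros c Hc.
    destruct (ivt_between f (Rmin t m) (Rmax t m) c Hf) as [s [Hs Hfs]].
    - apply Rle_trans with t; [apply Rmin_l|apply Rmax_l].
    - unfold covers, Rmin, Rmax. destruct (Rle_dec t m); lra.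
    - rewrite <- Hfs. apply Hint.
      assert (s <> t) by (intros ->; lra). assert (s <> m) by (intros ->; lra).
      unfold Rmin, Rmax in Hs. destruct (Rle_dec t m); lra. }
  destruct (Rtotal_order (f t) (f m)) as [Hlt|[He|Hgt]].
  - apply (not_int_between (k - 1) (Rmax ((f t + f m) / 2) (IZR k - 1 / 2))).
    + rewrite minus_IZR. unfold Rmax. destruct (Rle_dec _ _); lra.
    + apply Hval. unfold Rmax; destruct (Rle_dec _ _); lra.
  - lra.
  - apply (not_int_between k (Rmin ((f t + f m) / 2) (IZR k + 1 / 2))).
    + unfold Rmin. destruct (Rle_dec _ _); lra.
    + apply Hval. unfold Rmin; destruct (Rle_dec _ _); lra.
Qed.

(** Extends functions of the height to the whole line, so that continuity on
the line can be used throughout. *)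
Definition clamp01 (y : R) : R := Rmax 0 (Rmin y 1).

Lemma clamp01_range y : 0 <= clamp01 y <= 1.
Proof. unfold clamp01, Rmax, Rmin. repeat destruct (Rle_dec _ _); lra. Qed.

Lemma clamp01_id y : 0 <= y <= 1 -> clamp01 y = y.
Proof. unfold clamp01, Rmax, Rmin. repeat destruct (Rle_dec _ _); lra. Qed.

Lemma clamp01_cont : continuity clamp01.
Proof.
  intros x eps Heps. exists eps. split; [exact Heps|]. intros t [_ Ht].
  simpl in *. unfold Rdist in *. unfold clamp01, Rmax, Rmin.
  apply Rabs_def2 in Ht. apply Rabs_def1; repeat destruct (Rle_dec _ _); lra.
Qed.

Definition translate (k : Z) (z : C) : C := (fst z + IZR k, snd z).

Lemma translate_add (k : Z) (z : C) : (z + RtoC (IZR k))%C = translate k z.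
Proof. unfold translate, Cplus, RtoC. simpl. f_equal. lra. Qed.

Lemma translate_translate (j k : Z) (z : C) : translate j (translate k z) = translate (j + k) z.
Proof. unfold translate. simpl. rewrite plus_IZR. f_equal. lra. Qed.

Lemma translate_0 (z : C) : translate 0 z = z.
Proof. destruct z. unfold translate. simpl. f_equal. lra. Qed.

Lemma Sspace_translate (k : Z) (z : C) : Sspace z -> Sspace (translate k z).
Proof.
  intros [H|[[m H] H']]; [left; exact H|right; split; [|exact H']].
  exists (m + k)%Z. unfold translate, Re in *. simpl in *. rewrite H, plus_IZR. reflexivity.
Qed.

Lemma Sspace_axis (x : R) : Sspace (x, 0).
Proof. left. reflexivity. Qed.

Lemma Sspace_stem (y : R) : 0 <= y <= 1 -> Sspace (0, y).
Proof. intros H. right. split; [exists 0%Z; reflexivity|exact H]. Qed.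

Lemma Sspace_inv (z : C) : Sspace z -> 0 <= snd z <= 1 /\ (0 < snd z -> is_int (fst z)).
Proof.
  intros [H|[H H']].
  - unfold real_axis, Im in H. rewrite H. split; [lra|intros; lra].
  - split; [exact H'|]. intros _. exact H.
Qed.

(** * The map in coordinates *)

Definition axisRe (F : C -> C) (x : R) : R := fst (F (x, 0)).
Definition axisIm (F : C -> C) (x : R) : R := snd (F (x, 0)).
Definition stemRe (F : C -> C) (y : R) : R := fst (F (0, clamp01 y)).
Definition stemIm (F : C -> C) (y : R) : R := snd (F (0, clamp01 y)).

Section Dynamics.
Context (F : C -> C) (HF : L1 F).

Lemma F_S (z : C) : Sspace z -> Sspace (F z).
Proof. apply HF. Qed.

Lemma iter_S (n : nat) (z : C) : Sspace z -> Sspace (Nat.iter n F z).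
Proof. intros Hz. induction n as [|n IH]; simpl; [exact Hz|]. apply F_S, IH. Qed.

Lemma F_shift (k : Z) (z : C) : Sspace z -> F (translate k z) = translate k (F z).
Proof.
  assert (one : forall z, Sspace z -> F (translate 1 z) = translate 1 (F z)).
  { intros w Hw. destruct HF as (_ & _ & H). specialize (H w Hw).
    rewrite <- (translate_add 1 w), <- (translate_add 1 (F w)). exact H. }
  assert (nonneg : forall (n : nat) z, Sspace z -> F (translate (Z.of_nat n) z) = translate (Z.of_nat n) (F z)).
  { induction n as [|n IH]; intros w Hw; [now rewrite !translate_0|].
    replace (Z.of_nat (S n)) with (1 + Z.of_nat n)%Z by lia.
    rewrite <- !translate_translate, one, IH; auto. apply Sspace_translate, Hw. }
  intros Hz. destruct (Z_le_gt_dec 0 k) as [Hk|Hk].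
  - rewrite <- (Z2Nat.id k Hk). apply nonneg, Hz.
  - pose proof (nonneg (Z.to_nat (- k)) (translate k z) (Sspace_translate k z Hz)) as H.
    rewrite Z2Nat.id in H by lia. rewrite translate_translate in H.
    replace (- k + k)%Z with 0%Z in H by lia. rewrite translate_0 in H.
    rewrite H, translate_translate. replace (k + - k)%Z with 0%Z by lia. now rewrite translate_0.
Qed.

Lemma iter_shift (n : nat) (k : Z) (z : C) :
  Sspace z -> Nat.iter n F (translate k z) = translate k (Nat.iter n F z).
Proof.
  intros Hz. induction n as [|n IH]; simpl; [reflexivity|].
  rewrite IH, F_shift; [reflexivity|]. apply iter_S, Hz.
Qed.

Lemma cont_step (px py : R -> R) :
  continuity px -> continuity py -> (forall t, Sspace (px t, py t)) ->
  continuity (fun t => fst (F (px t, py t))) /\ continuity (fun t => snd (F (px t, py t))).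
Proof.
  intros Hx Hy HS. destruct HF as (_ & Hc & _).
  assert (lim : forall t, filterlim (fun t => F (px t, py t)) (locally t) (locally (F (px t, py t)))).
  { intros t. apply filterlim_comp with (G := within Sspace (locally (px t, py t)));
      [|apply Hc, HS].
    intros P HP. unfold within in HP. unfold filtermap.
    destruct HP as [eps HP].
    assert (Hx' : continuous px t) by (apply continuity_pt_filterlim, Hx).
    assert (Hy' : continuous py t) by (apply continuity_pt_filterlim, Hy).
    assert (Bx := proj1 (filterlim_locally px (px t)) Hx' eps).
    assert (By := proj1 (filterlim_locally py (py t)) Hy' eps).
    generalize (filter_and _ _ Bx By). apply filter_imp. intros s [B1 B2].
    apply HP; [split; assumption|apply HS]. }
  split; intros t; apply continuity_pt_filterlim.
  - apply (filterlim_comp _ _ _ (fun t => F (px t, py t)) fst _ (locally (F (px t, py t)))); [apply lim|].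
    apply filterlim_locally. intros eps. exists eps. intros z [Hz _]. exact Hz.
  - apply (filterlim_comp _ _ _ (fun t => F (px t, py t)) snd _ (locally (F (px t, py t)))); [apply lim|].
    apply filterlim_locally. intros eps. exists eps. intros z [_ Hz]. exact Hz.
Qed.

Lemma cont_iter (px py : R -> R) (n : nat) :
  continuity px -> continuity py -> (forall t, Sspace (px t, py t)) ->
  continuity (fun t => fst (Nat.iter n F (px t, py t))) /\
  continuity (fun t => snd (Nat.iter n F (px t, py t))).
Proof.
  intros Hx Hy HS. induction n as [|n [IH1 IH2]]; simpl; [split; assumption|].
  destruct (cont_step _ _ IH1 IH2) as [H1 H2].
  - intros t. rewrite <- surjective_pairing. apply iter_S, HS.
  - split; intros t; [specialize (H1 t)|specialize (H2 t)].
    + revert H1. apply continuity_pt_ext. intros s. now rewrite <- surjective_pairing.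
    + revert H2. apply continuity_pt_ext. intros s. now rewrite <- surjective_pairing.
Qed.

Lemma cont_axis (n : nat) :
  continuity (fun x => fst (Nat.iter n F (x, 0))) /\ continuity (fun x => snd (Nat.iter n F (x, 0))).
Proof.
  apply (cont_iter (fun x => x) (fun _ => 0)).
  - apply derivable_continuous, derivable_id.
  - apply continuity_const. intros x y. reflexivity.
  - intros t. apply Sspace_axis.
Qed.

Lemma cont_stem (n : nat) :
  continuity (fun y => fst (Nat.iter n F (0, clamp01 y))) /\
  continuity (fun y => snd (Nat.iter n F (0, clamp01 y))).
Proof.
  apply (cont_iter (fun _ => 0) clamp01).
  - apply continuity_const. intros x y. reflexivity.
  - apply clamp01_cont.
  - intros t. apply Sspace_stem, clamp01_range.
Qed.

Lemma axisRe_cont : continuity (axisRe F). Proof. apply (cont_axis 1). Qed.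
Lemma axisIm_cont : continuity (axisIm F). Proof. apply (cont_axis 1). Qed.
Lemma stemRe_cont : continuity (stemRe F). Proof. apply (cont_stem 1). Qed.
Lemma stemIm_cont : continuity (stemIm F). Proof. apply (cont_stem 1). Qed.

Lemma axis_shift (k : Z) (x : R) :
  axisRe F (x + IZR k) = axisRe F x + IZR k /\ axisIm F (x + IZR k) = axisIm F x.
Proof.
  unfold axisRe, axisIm. change (x + IZR k, 0) with (translate k (x, 0)).
  rewrite F_shift by apply Sspace_axis. split; reflexivity.
Qed.

Lemma axisIm_range x : 0 <= axisIm F x <= 1.
Proof. apply (Sspace_inv (F (x, 0))), F_S, Sspace_axis. Qed.

Lemma axis_int x : 0 < axisIm F x -> is_int (axisRe F x).
Proof. apply (Sspace_inv (F (x, 0))), F_S, Sspace_axis. Qed.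

Lemma stemIm_range y : 0 <= stemIm F y <= 1.
Proof. apply (Sspace_inv (F (0, clamp01 y))), F_S, Sspace_stem, clamp01_range. Qed.

Lemma stem_int y : 0 < stemIm F y -> is_int (stemRe F y).
Proof. apply (Sspace_inv (F (0, clamp01 y))), F_S, Sspace_stem, clamp01_range. Qed.

Lemma stem_0 : stemRe F 0 = axisRe F 0 /\ stemIm F 0 = axisIm F 0.
Proof. unfold stemRe, stemIm, axisRe, axisIm. rewrite clamp01_id by lra. split; reflexivity. Qed.

Lemma axis_step (x : R) : F (x, 0) = (axisRe F x, axisIm F x).
Proof. apply surjective_pairing. Qed.

Lemma stem_step (y : R) : 0 <= y <= 1 -> F (0, y) = (stemRe F y, stemIm F y).
Proof. intros Hy. unfold stemRe, stemIm. rewrite clamp01_id by exact Hy. apply surjective_pairing. Qed.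

(** * Two criteria for a period *)

Lemma per_intro (z : C) (n : nat) :
  Sspace z -> (1 <= n)%nat -> snd (Nat.iter n F z) = snd z -> is_int (fst (Nat.iter n F z) - fst z) ->
  (forall j, (1 <= j < n)%nat -> snd (Nat.iter j F z) = snd z -> ~ is_int (fst (Nat.iter j F z) - fst z)) ->
  Per F n.
Proof.
  intros HS Hn Him [k Hk] Hmin. exists z. split; [exact HS|]. split; [exact Hn|]. split.
  - exists k. rewrite translate_add. unfold translate. rewrite (surjective_pairing (Nat.iter n F z)).
    f_equal; [lra|exact Him].
  - intros m Hm [j Hj]. destruct (le_lt_dec n m) as [H|H]; [exact H|exfalso].
    rewrite translate_add in Hj. apply (Hmin m).
    + lia.
    + rewrite Hj. reflexivity.
    + rewrite Hj. exists j. simpl. lra.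
Qed.

(** A positive height forces an integer real part, so on the branches the
height alone decides about returns mod 1. *)
Lemma per_of_stem (y : R) (n : nat) :
  0 < y <= 1 -> (1 <= n)%nat -> snd (Nat.iter n F (0, y)) = y ->
  (forall j, (1 <= j < n)%nat -> snd (Nat.iter j F (0, y)) <> y) -> Per F n.
Proof.
  intros Hy Hn Him Hmin. apply (per_intro (0, y)).
  - apply Sspace_stem; lra.
  - exact Hn.
  - exact Him.
  - simpl. rewrite Rminus_0_r. apply (Sspace_inv (Nat.iter n F (0, y))).
    + apply iter_S, Sspace_stem; lra.
    + rewrite Him; lra.
  - intros j Hj Hs. contradiction (Hmin j Hj Hs).
Qed.

(** Let y be the lowest height that the n-th iterate preserves; below y this
iterate raises heights.  If y came back after j < n steps, the j-th image of
[0,y] would join the axis to the branch, hence contain the foot of that branch: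
some x < y is at an integer at time j.  At time n it is then at an image of 0
by fewer than n steps, at height 0, so it has not been raised. *)
Lemma per_of_first_climb (n : nat) :
  (1 <= n)%nat -> (forall i, (i < n)%nat -> snd (Nat.iter i F (0, 0)) = 0) ->
  0 < snd (Nat.iter n F (0, 0)) -> Per F n.
Proof.
  intros Hn Hreal Hclimb.
  pose (eta := fun j y => snd (Nat.iter j F (0, clamp01 y))).
  assert (Heta : forall j, continuity (eta j)) by (intros j; apply cont_stem).
  assert (Heta1 : forall j y, 0 <= eta j y <= 1).
  { intros j y. apply (Sspace_inv (Nat.iter j F (0, clamp01 y))), iter_S, Sspace_stem, clamp01_range. }
  assert (Hc0 : clamp01 0 = 0) by (apply clamp01_id; lra).
  destruct (first_ge (fun y => y - eta n y) 0 1 0) as [y [Hy [Hfix Hbefore]]].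
  - apply continuity_minus; [apply derivable_continuous, derivable_id|apply Heta].
  - lra.
  - specialize (Heta1 n 0). lra.
  - specialize (Heta1 n 1). lra.
  - assert (Hy0 : y <> 0) by (intros ->; unfold eta in Hfix; rewrite Hc0 in Hfix; lra).
    apply (per_of_stem y n); [lra|exact Hn| |].
    + unfold eta in Hfix. rewrite clamp01_id in Hfix by lra. lra.
    + intros j Hj He.
      assert (Hej : eta j y = y) by (unfold eta; rewrite clamp01_id; [exact He|lra]).
      destruct (last_le (eta j) 0 y 0) as [x [Hx [Hx0 Hafter]]].
      * apply Heta.
      * lra.
      * unfold eta. rewrite Hc0. rewrite Hreal by lia. lra.
      * lra.
      * assert (Hxy : x <> y) by (intros ->; lra).
        destruct (int_valued_const (fun t => fst (Nat.iter j F (0, clamp01 t))) x y) as [k Hk].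
        -- apply cont_stem.
        -- lra.
        -- intros t Ht. apply (Sspace_inv (Nat.iter j F (0, clamp01 t))).
           ++ apply iter_S, Sspace_stem, clamp01_range.
           ++ apply Hafter; lra.
        -- assert (Hpt : Nat.iter j F (0, clamp01 x) = translate k (0, 0)).
           { rewrite (surjective_pairing (Nat.iter j F (0, clamp01 x))).
             rewrite Hk by lra. unfold eta in Hx0. rewrite Hx0. unfold translate; simpl. f_equal. lra. }
           assert (Hz : eta n x = 0).
           { unfold eta. replace n with ((n - j) + j)%nat by lia. rewrite iter_add, Hpt.
             rewrite iter_shift by apply Sspace_axis. simpl. apply Hreal. lia. }
           specialize (Hbefore x). lra.
Qed.

Definition circle_cycle (n : nat) (x : R) : Prop :=
  is_int (Nat.iter n (axisRe F) x - x) /\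
  forall j, (1 <= j < n)%nat -> ~ is_int (Nat.iter j (axisRe F) x - x).

Lemma axisRe_iter_shift (n : nat) (k : Z) (x : R) :
  Nat.iter n (axisRe F) (x + IZR k) = Nat.iter n (axisRe F) x + IZR k.
Proof.
  induction n as [|n IH]; simpl; [reflexivity|]. rewrite IH. apply axis_shift.
Qed.

Lemma real_orbit (n : nat) (x : R) :
  (forall i, (1 <= i <= n)%nat -> axisIm F (Nat.iter (i - 1) (axisRe F) x) = 0) ->
  forall i, (i <= n)%nat -> Nat.iter i F (x, 0) = (Nat.iter i (axisRe F) x, 0).
Proof.
  intros H i Hi. induction i as [|i IH]; [reflexivity|].
  simpl. rewrite IH by lia. rewrite axis_step.
  specialize (H (S i)). replace (S i - 1)%nat with i in H by lia. rewrite H by lia. reflexivity.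
Qed.

Lemma is_int_opp x : is_int x -> is_int (- x).
Proof. intros [k ->]. exists (- k)%Z. now rewrite opp_IZR. Qed.
Lemma is_int_plus x y : is_int x -> is_int y -> is_int (x + y).
Proof. intros [k ->] [j ->]. exists (k + j)%Z. now rewrite plus_IZR. Qed.
Lemma is_int_minus x y : is_int x -> is_int y -> is_int (x - y).
Proof. intros Hx Hy. apply is_int_plus; [exact Hx|apply is_int_opp, Hy]. Qed.

(** A cycle of g that is not an orbit of F contains a step where F climbs, and
the g-image of that step is an integer.  Points of the cycle are distinct
mod 1, so only one of them is an integer: started there, the F-orbit stays on
the axis until it climbs, at time n exactly. *)
Lemma per_of_circle_cycle (n : nat) (x : R) : (1 <= n)%nat -> circle_cycle n x -> Per F n.
Proof.
  intros Hn [Hret Hmin].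
  destruct (classic (forall i, (1 <= i <= n)%nat -> axisIm F (Nat.iter (i - 1) (axisRe F) x) = 0)) as [Hall|Hnot].
  - pose proof (real_orbit n x Hall) as Horb.
    apply (per_intro (x, 0)).
    + apply Sspace_axis.
    + exact Hn.
    + rewrite Horb by lia. reflexivity.
    + rewrite Horb by lia. exact Hret.
    + intros j Hj _. rewrite Horb by lia. apply Hmin, Hj.
  - (* restart the cycle at the integer under the branch it climbs *)
    assert (Hex : exists i, (1 <= i <= n)%nat /\ 0 < axisIm F (Nat.iter (i - 1) (axisRe F) x)).
    { apply NNPP. intros Hno. apply Hnot. intros i Hi.
      destruct (axisIm_range (Nat.iter (i - 1) (axisRe F) x)) as [[H|H] _]; [|auto].
      exfalso. apply Hno. exists i. auto. }
    destruct Hex as [i [Hi Hup]].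
    assert (Hq : is_int (Nat.iter i (axisRe F) x)).
    { replace i with (S (i - 1)) by lia. simpl. apply axis_int, Hup. }
    destruct Hq as [q Hq]. destruct Hret as [m Hm].
    assert (Horb0 : forall j, Nat.iter j (axisRe F) 0 = Nat.iter (j + i) (axisRe F) x - IZR q).
    { intros j. rewrite iter_add, Hq.
      replace (IZR q) with (0 + IZR q) at 1 by lra. rewrite axisRe_iter_shift. lra. }
    assert (Hper : forall j, Nat.iter (j + n) (axisRe F) x = Nat.iter j (axisRe F) x + IZR m).
    { intros j. rewrite iter_add. replace (Nat.iter n (axisRe F) x) with (x + IZR m) by lra.
      apply axisRe_iter_shift. }
    assert (Hni : forall j, (1 <= j < n)%nat -> ~ is_int (Nat.iter j (axisRe F) 0)).
    { intros j Hj Hint. rewrite Horb0 in Hint.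
      assert (Hint' : is_int (Nat.iter (j + i) (axisRe F) x)).
      { replace (Nat.iter (j + i) (axisRe F) x) with (Nat.iter (j + i) (axisRe F) x - IZR q + IZR q) by lra.
        apply is_int_plus; [exact Hint|exists q; reflexivity]. }
      destruct Hint' as [r Hr].
      (* moving on by n - i steps returns to x mod 1 both from time i and from time j + i *)
      apply (Hmin j Hj).
      assert (E1 : Nat.iter (n - i + i) (axisRe F) x = x + IZR m)
        by (replace (n - i + i)%nat with n by lia; lra).
      assert (E2 : Nat.iter (n - i + (j + i)) (axisRe F) x = Nat.iter j (axisRe F) x + IZR m)
        by (replace (n - i + (j + i))%nat with (j + n)%nat by lia; apply Hper).
      rewrite iter_add, Hq in E1. rewrite iter_add, Hr in E2.
      replace (IZR q) with (0 + IZR q) in E1 by lra. rewrite axisRe_iter_shift in E1.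
      replace (IZR r) with (0 + IZR r) in E2 by lra. rewrite axisRe_iter_shift in E2.
      exists (r - q)%Z. rewrite minus_IZR. lra. }
    assert (Horb : forall j, (j < n)%nat -> Nat.iter j F (0, 0) = (Nat.iter j (axisRe F) 0, 0)).
    { intros j Hj. apply (real_orbit (n - 1) 0); [|lia].
      intros l Hl. destruct (axisIm_range (Nat.iter (l - 1) (axisRe F) 0)) as [[H|H] _]; [|auto].
      exfalso. apply (Hni l); [lia|]. replace l with (S (l - 1)) by lia. simpl. apply axis_int, H. }
    apply per_of_first_climb.
    + exact Hn.
    + intros j Hj. rewrite Horb by exact Hj. reflexivity.
    + replace n with (S (n - 1)) by lia. simpl. rewrite Horb by lia.
      change (0 < axisIm F (Nat.iter (n - 1) (axisRe F) 0)).
      rewrite Horb0. replace (n - 1 + i)%nat with (i - 1 + n)%nat by lia. rewrite Hper.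
      replace (Nat.iter (i - 1) (axisRe F) x + IZR m - IZR q)
        with (Nat.iter (i - 1) (axisRe F) x + IZR (m - q)) by (rewrite minus_IZR; lra).
      rewrite (proj2 (axis_shift _ _)). exact Hup.
Qed.

(** If the j-th image of x were x + m with j < n, the image after j n steps
would be both x + n m and x, so m = 0. *)
Lemma per_of_exact_cycle (n : nat) (x : R) :
  (1 <= n)%nat -> exact_cycle (axisRe F) n x -> Per F n.
Proof.
  intros Hn [Hfix Hne]. apply (per_of_circle_cycle n x Hn). split.
  - rewrite Hfix. exists 0%Z. lra.
  - intros j Hj [m Hm]. apply (Hne j Hj).
    assert (Hmul : forall i, Nat.iter (i * j) (axisRe F) x = x + INR i * IZR m).
    { induction i as [|i IH]; [simpl; lra|]. rewrite S_INR.
      replace (S i * j)%nat with (i * j + j)%nat by lia. rewrite iter_add.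
      replace (Nat.iter j (axisRe F) x) with (x + IZR m) by lra.
      rewrite axisRe_iter_shift, IH. lra. }
    assert (Hn' : forall i, Nat.iter (i * n) (axisRe F) x = x).
    { induction i as [|i IH]; [reflexivity|].
      replace (S i * n)%nat with (i * n + n)%nat by lia. now rewrite iter_add, Hfix. }
    specialize (Hmul n). rewrite Nat.mul_comm, Hn' in Hmul.
    assert (INR n <> 0) by (apply not_0_INR; lia).
    assert (IZR m = 0) by nra. lra.
Qed.

Lemma per_of_triple (a b c : R) (n : nat) :
  (1 <= n)%nat -> a < b -> b < c ->
  (axisRe F a <= b /\ c <= axisRe F b /\ axisRe F c <= a) \/
  (c <= axisRe F a /\ axisRe F b <= a /\ b <= axisRe F c) -> Per F n.
Proof.
  intros Hn Hab Hbc [(H1 & H2 & H3)|(H1 & H2 & H3)].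
  - destruct (li_yorke_exact (axisRe F) a b c n) as (x & Hx & _); auto using axisRe_cont.
    apply (per_of_exact_cycle n x Hn Hx).
  - destruct (li_yorke_exact_opp (axisRe F) a b c n) as (x & Hx & _); auto using axisRe_cont.
    apply (per_of_exact_cycle n x Hn Hx).
Qed.

End Dynamics.

(** * Circle maps without barriers *)

Definition lower_barrier (g : R -> R) (z : R) : Prop := forall s, z <= s -> z <= g s.
Definition upper_barrier (g : R -> R) (y : R) : Prop := forall s, s <= y -> g s <= y.

Definition degree_one (g : R -> R) : Prop := forall (x : R) (k : Z), g (x + IZR k) = g x + IZR k.

Lemma int_below (x : R) : exists k : Z, IZR k <= x < IZR k + 1.
Proof.
  exists (up x - 1)%Z. rewrite minus_IZR. pose proof (archimed x). lra.
Qed.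

Lemma int_left (x : R) : exists k : Z, IZR k < x <= IZR k + 1.
Proof.
  destruct (int_below (- x)) as [k Hk]. exists (- k - 1)%Z. rewrite minus_IZR, opp_IZR. lra.
Qed.

Lemma displacement_bound (g : R -> R) :
  continuity g -> degree_one g -> exists C, 0 <= C /\ forall x, x - C <= g x <= x + C.
Proof.
  intros Hg H1.
  assert (Hd : continuity (fun x => g x - x))
    by (apply continuity_minus; [exact Hg|apply derivable_continuous, derivable_id]).
  destruct (continuity_ab_maj (fun x => g x - x) 0 1) as [M [HM _]]; [lra|intros; apply Hd|].
  destruct (continuity_ab_min (fun x => g x - x) 0 1) as [m [Hm _]]; [lra|intros; apply Hd|].
  exists (Rabs (g M - M) + Rabs (g m - m)).
  pose proof (Rabs_pos (g M - M)). pose proof (Rabs_pos (g m - m)).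
  pose proof (Rle_abs (g M - M)). pose proof (Rle_abs (- (g m - m))) as Hn. rewrite Rabs_Ropp in Hn.
  split; [lra|]. intros x. destruct (int_below x) as [k Hk].
  specialize (HM (x - IZR k)). specialize (Hm (x - IZR k)).
  assert (E : g x = g (x - IZR k) + IZR k) by (rewrite <- H1; f_equal; lra).
  lra.
Qed.

Lemma nat_crossing (P : nat -> Prop) (n : nat) : ~ P 0%nat -> P n -> exists j, (j < n)%nat /\ ~ P j /\ P (S j).
Proof.
  intros H0. induction n as [|n IH]; intros Hn; [contradiction|].
  destruct (classic (P n)) as [H|H].
  - destruct (IH H) as [j (Hj & H1 & H2)]. exists j. repeat split; auto.
  - exists n. auto.
Qed.

(** Let mu y be the last point that g sends to y.  It lies right of y because
there is no lower barrier, and the points q i obtained by iterating mu are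
unbounded, since their supremum would be a lower barrier.  Displacements being
bounded by C, a preimage p < q J of a point q J > q 0 + C is still right of
q 0; it exists because there is no upper barrier.  The triple consists of p,
of the first q (j+1) beyond p, and of the larger of q j and a preimage of p on
the left of p. *)
Lemma triple_of_no_barrier (g : R -> R) :
  continuity g -> degree_one g ->
  ~ (exists z, lower_barrier g z) -> ~ (exists y, upper_barrier g y) ->
  exists h p q, h < p /\ p < q /\ g h <= p /\ q <= g p /\ g q <= h.
Proof.
  intros Hg H1 Hlow Hup.
  destruct (displacement_bound g Hg H1) as [C [HC HCg]].
  assert (Hlam : forall y, exists x, g x = y /\ x < y).
  { intros y. apply NNPP. intros Hno. apply Hup. exists y. intros s Hs.
    apply Rnot_lt_le. intros Hgt.
    destruct (ivt_between g (Rmin s (y - C)) s y Hg) as [x [Hx Hgx]].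
    - apply Rmin_l.
    - left. pose proof (Rmin_r s (y - C)). pose proof (HCg (Rmin s (y - C))). lra.
    - apply Hno. exists x. split; [exact Hgx|].
      destruct (Req_dec x y) as [->|]; [|lra]. assert (s = y) as -> by lra. lra. }
  assert (Hmu : forall y, exists x, g x = y /\ y < x /\ forall t, x < t -> y < g t).
  { intros y. destruct (last_le g (y - C) (y + C + 1) y Hg) as [x [Hx [Hgx Hlast]]].
    - lra.
    - specialize (HCg (y - C)). lra.
    - specialize (HCg (y + C + 1)). lra.
    - assert (Hafter : forall t, x < t -> y < g t).
      { intros t Ht. destruct (Rle_dec t (y + C + 1)) as [Hle|Hle]; [apply Hlast; lra|].
        specialize (HCg t). lra. }
      exists x. split; [exact Hgx|]. split; [|exact Hafter].
      apply Rnot_le_lt. intros Hxy. apply Hlow. exists y. intros s Hs.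
      destruct (Req_dec s x) as [->|Hne]; [lra|]. left. apply Hafter. lra. }
  destruct (functional_choice _ Hmu) as [mu Hmu'].
  pose (q := fun i => Nat.iter (S i) mu 0).
  assert (Hq : forall i, g (q (S i)) = q i /\ q i < q (S i)).
  { intros i. destruct (Hmu' (q i)) as (E1 & E2 & _). split; assumption. }
  assert (Hgq : forall i, g (q i) <= q i).
  { intros i. destruct (Hmu' (Nat.iter i mu 0)) as (E1 & E2 & _). unfold q. simpl. lra. }
  assert (Hmono : forall i j, (i <= j)%nat -> q i <= q j).
  { intros i j Hij. induction Hij as [|j _ IH]; [lra|]. pose proof (Hq j). lra. }
  assert (HJ : exists J, q 0%nat + C < q J).
  { apply NNPP. intros Hno.
    assert (Hbd : forall i, q i <= q 0%nat + C).
    { intros i. apply Rnot_lt_le. intros H. apply Hno. exists i. exact H. }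
    destruct (completeness (fun x => exists i, x = q i)) as [L [HL1 HL2]].
    - exists (q 0%nat + C). intros x [i ->]. apply Hbd.
    - exists (q 0%nat), 0%nat. reflexivity.
    - apply Hlow. exists L. intros s Hs. apply HL2. intros x [i ->].
      left. apply (Hmu' (q i)). change (q (S i) < s).
      assert (q (S (S i)) <= L) by (apply HL1; exists (S (S i)); reflexivity).
      pose proof (Hq (S i)). lra. }
  destruct HJ as [J HJ].
  destruct (Hlam (q J)) as [p [Hgp Hp]].
  assert (Hp0 : q 0%nat < p) by (specialize (HCg p); lra).
  destruct (nat_crossing (fun i => p < q i) J) as [j (Hj & Hj1 & Hj2)]; [lra|lra|].
  apply Rnot_lt_le in Hj1.
  assert (Hj1' : q j < p).
  { destruct Hj1 as [H|H]; [exact H|]. specialize (Hgq j). rewrite H in Hgq. lra. }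
  destruct (Hlam p) as [lp [Hglp Hlp]].
  exists (Rmax lp (q j)), p, (q (S j)).
  assert (Hmax : Rmax lp (q j) = lp \/ Rmax lp (q j) = q j)
    by (unfold Rmax; destruct (Rle_dec lp (q j)); auto).
  split; [destruct Hmax as [->| ->]; lra|]. split; [exact Hj2|].
  split; [destruct Hmax as [->| ->]; [lra|]; specialize (Hgq j); lra|].
  split; [rewrite Hgp; apply Hmono; lia|].
  rewrite (proj1 (Hq j)). apply Rmax_r.
Qed.

(** * Loops through a branch *)

Section Laps.
Context (F : C -> C) (HF : L1 F).
Let g := axisRe F.
Let Y := axisIm F.
Let U := stemRe F.
Let h := stemIm F.

Definition no_int (a b : R) : Prop := forall t, a < t < b -> ~ is_int t.

Lemma no_int_unit (k : Z) (a b : R) : IZR k <= a -> b <= IZR k + 1 -> no_int a b.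
Proof. intros Ha Hb t Ht. apply (not_int_between k). lra. Qed.

Lemma zero_on_closure (f : R -> R) (a b : R) :
  continuity f -> a < b -> (forall t, a < t < b -> f t = 0) -> forall t, a <= t <= b -> f t = 0.
Proof.
  intros Hf Hab H t Ht.
  destruct (int_valued_const f a b Hf Hab) as [k Hk].
  - intros s Hs. exists 0%Z. apply H, Hs.
  - rewrite Hk by exact Ht. rewrite <- (Hk ((a + b) / 2)) by lra. apply H. lra.
Qed.

(** The intervals on which loops are built: heights from 0 to top are covered at
time j and the branches are avoided before, so that a loop closed on such an
interval visits the branches exactly once. *)
Definition lap (top : R) (j : nat) (a b : R) : Prop :=
  a < b /\
  (forall t i, a <= t <= b -> (i < j)%nat -> snd (Nat.iter i F (t, 0)) = 0) /\
  onto_ends (fun t => snd (Nat.iter j F (t, 0))) a b 0 top.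

Lemma lap_shift (top : R) (j : nat) (a b : R) (k : Z) :
  lap top j a b -> lap top j (a + IZR k) (b + IZR k).
Proof.
  assert (E : forall i t, snd (Nat.iter i F (t + IZR k, 0)) = snd (Nat.iter i F (t, 0))).
  { intros i t. change (t + IZR k, 0) with (translate k (t, 0)).
    rewrite (iter_shift F HF) by apply Sspace_axis. reflexivity. }
  intros (H1 & H2 & H3). split; [lra|]. split.
  - intros t i Ht Hi. replace t with (t - IZR k + IZR k) by lra. rewrite E. apply H2; [lra|exact Hi].
  - unfold onto_ends in *. now rewrite !E.
Qed.

Lemma axis_real (c d a b : R) :
  c < d -> no_int a b -> (forall t, c < t < d -> a < g t < b) ->
  forall t, c <= t <= d -> F (t, 0) = (g t, 0).
Proof.
  intros Hcd Hni Hin t Ht. rewrite axis_step. fold (g t). f_equal.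
  apply (zero_on_closure Y c d); [apply axisIm_cont, HF|exact Hcd| |exact Ht].
  intros s Hs. destruct (axisIm_range F HF s) as [[H|H] _]; [|symmetry; exact H].
  exfalso. apply (Hni (g s)); [apply Hin, Hs|apply axis_int; assumption].
Qed.

(** Points that climb are sent over integers.  Hence where g takes its values
in an interval without integers F does not leave the axis, and a covering by g
pulls laps back by one step. *)
Lemma lap_pull (top : R) (j : nat) (a b c d : R) :
  lap top j a b -> no_int a b -> c <= d -> covers g c d a b ->
  exists c' d', c <= c' /\ d' <= d /\ lap top (S j) c' d' /\ forall t, c' < t < d' -> a < g t < b.
Proof.
  intros (Hab & Hreal & Hends) Hni Hcd Hcov.
  destruct (cover_sub g c d a b) as (c' & d' & H1 & H2 & H3 & H4 & H5);
    [apply axisRe_cont, HF|exact Hcd|exact Hab|exact Hcov|].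
  exists c', d'. split; [exact H1|]. split; [exact H3|]. split; [|exact H5].
  pose proof (axis_real c' d' a b H2 Hni H5) as Hstep.
  split; [exact H2|]. split.
  - intros t i Ht Hi. destruct i as [|i]; [reflexivity|].
    rewrite iter_succ_r, Hstep by exact Ht. apply Hreal; [|lia].
    apply (onto_ends_range g c' d' a b Hab H4 H5 t Ht).
  - unfold onto_ends. rewrite !iter_succ_r, !Hstep by lra.
    destruct H4 as [[-> ->]|[-> ->]]; [exact Hends|]. destruct Hends; [right|left]; tauto.
Qed.

(** Some height y <= top is preserved by S j steps, by the intermediate value
theorem.  At the times between, the orbit is on the axis, at height 0, so the
period of y is S j as soon as y > 0; the last hypothesis serves to exclude
y = 0. *)
Lemma lap_close (top : R) (j : nat) (a b d1 d2 : R) :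
  lap top j a b -> no_int a b -> 0 <= d1 <= d2 -> d2 <= top <= 1 -> covers U d1 d2 a b ->
  (0 < d1 \/ U 0 < a \/ b < U 0) -> Per F (S j).
Proof.
  intros (Hab & Hreal & Hends) Hni Hd Htop Hcov Hpos.
  destruct (cover_sub U d1 d2 a b) as (c & d & H1 & H2 & H3 & H4 & H5);
    [apply stemRe_cont, HF|lra|exact Hab|exact Hcov|].
  assert (Hstep : forall y, c <= y <= d -> F (0, y) = (U y, 0)).
  { intros y Hy. rewrite (stem_step F) by lra. fold (U y). f_equal.
    apply (zero_on_closure h c d); [apply stemIm_cont, HF|exact H2| |exact Hy].
    intros s Hs. destruct (stemIm_range F HF s) as [[H|H] _]; [|symmetry; exact H].
    exfalso. apply (Hni (U s)); [apply H5, Hs|apply stem_int; assumption]. }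
  assert (HU : forall y, c <= y <= d -> a <= U y <= b)
    by apply (onto_ends_range U c d a b Hab H4 H5).
  destruct (fixed_of_ends (fun y => snd (Nat.iter (S j) F (0, clamp01 y))) c d 0 top) as [y [Hy Hfix]].
  - apply cont_stem, HF.
  - lra.
  - lra.
  - lra.
  - unfold onto_ends. rewrite !iter_succ_r, !clamp01_id by lra. rewrite !Hstep by lra.
    destruct H4 as [[-> ->]|[-> ->]]; [exact Hends|]. destruct Hends; [right|left]; tauto.
  - rewrite clamp01_id in Hfix by lra.
    assert (Hy0 : y <> 0).
    { intros ->. specialize (HU 0 ltac:(lra)). lra. }
    apply (per_of_stem F HF y); [lra|lia|exact Hfix|].
    intros i Hi He. destruct i as [|i]; [lia|].
    rewrite iter_succ_r, Hstep in He by lra. rewrite Hreal in He; [lra|apply HU; lra|lia].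
Qed.

Lemma climb_left (e t : R) : e <= t -> Y e = 0 -> 0 < Y t ->
  exists a, e <= a < t /\ Y a = 0 /\ forall s, a < s <= t -> 0 < Y s.
Proof.
  intros Het He Ht.
  destruct (last_le Y e t 0) as [a (Ha & Ha0 & Hafter)]; [apply axisIm_cont, HF|exact Het|lra|lra|].
  exists a. split; [|split; assumption]. assert (a <> t) by (intros ->; lra). lra.
Qed.

Lemma climb_right (e t : R) : t <= e -> Y e = 0 -> 0 < Y t ->
  exists b, t < b <= e /\ Y b = 0 /\ forall s, t <= s < b -> 0 < Y s.
Proof.
  intros Het He Ht.
  destruct (first_ge (fun s => - Y s) t e 0) as [b (Hb & Hb0 & Hbefore)];
    [apply continuity_opp, axisIm_cont, HF|exact Het|lra|lra|].
  exists b. assert (b <> t) by (intros ->; lra). split; [lra|]. split; [lra|].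
  intros s Hs. specialize (Hbefore s Hs). lra.
Qed.

Lemma lap_one (top a b : R) : a < b -> onto_ends Y a b 0 top -> lap top 1 a b.
Proof.
  intros Hab He. split; [exact Hab|]. split; [|exact He].
  intros t i _ Hi. replace i with 0%nat by lia. reflexivity.
Qed.

Lemma const_of_climb (a b : R) : a < b -> (forall s, a < s < b -> 0 < Y s) ->
  exists k : Z, forall s, a <= s <= b -> g s = IZR k.
Proof.
  intros Hab H. apply int_valued_const; [apply axisRe_cont, HF|exact Hab|].
  intros t Ht. apply axis_int; [exact HF|]. apply H, Ht.
Qed.

(** If all points between a and b climbed, g would be constant there. *)
Lemma zero_between (a b : R) : a < b -> g a <> g b -> exists e, a < e < b /\ Y e = 0.
Proof.
  intros Hab Hne. apply NNPP. intros Hno. apply Hne.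
  destruct (const_of_climb a b Hab) as [k Hk].
  - intros s Hs. destruct (axisIm_range F HF s) as [[H|H] _]; [exact H|].
    exfalso. apply Hno. exists s. split; [exact Hs|symmetry; exact H].
  - rewrite !Hk by lra. reflexivity.
Qed.

Lemma g_shift (x : R) (k : Z) : g (x + IZR k) = g x + IZR k.
Proof. apply axis_shift, HF. Qed.

Lemma Y_shift (x : R) (k : Z) : Y (x + IZR k) = Y x.
Proof. apply axis_shift, HF. Qed.

Lemma lower_shift (z : R) (k : Z) : lower_barrier g z -> lower_barrier g (z + IZR k).
Proof.
  intros H s Hs. specialize (H (s + IZR (- k))). rewrite g_shift, opp_IZR in H. lra.
Qed.

Lemma upper_shift (z : R) (k : Z) : upper_barrier g z -> upper_barrier g (z + IZR k).
Proof.
  intros H s Hs. specialize (H (s + IZR (- k))). rewrite g_shift, opp_IZR in H. lra.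
Qed.

(** Let (a,b) be the bump around ts: its points climb, its ends do not.  If the
g-orbit of 0 visits the bump, it is at an integer one step later and repeats
itself mod 1, so it visits only one of the two sides (a,ts) and (ts,b).  The
other side is a lap that can be pulled back any number of times by the
surjective map g, no integer ever appearing in the interior.  As U covers
[-1,0], a full turn of the circle, every lap so obtained closes. *)
Lemma periods_of_full_turn (top : R) (ts ys : R) :
  Y ts = top -> 0 < top <= 1 -> 0 < g 0 -> 0 <= ys <= top -> U ys <= -1 ->
  forall n, (2 <= n)%nat -> Per F n.
Proof.
  intros Hts Htop Hg0 Hys HU.
  assert (Hg1 : g (ts + 1) = g ts + 1) by apply (g_shift ts 1).
  assert (Hg2 : g (ts + -1) = g ts + -1) by apply (g_shift ts (-1)).
  destruct (zero_between (ts + -1) ts) as [e1 [He1 He1']]; [lra|lra|].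
  destruct (zero_between ts (ts + 1)) as [e2 [He2 He2']]; [lra|lra|].
  destruct (climb_left e1 ts) as (a & Ha & Ha0 & Hal); [lra|exact He1'|lra|].
  destruct (climb_right e2 ts) as (b & Hb & Hb0 & Hbr); [lra|exact He2'|lra|].
  destruct (const_of_climb a b) as [k Hk]; [lra| |].
  { intros s Hs. destruct (Rle_dec s ts); [apply Hal|apply Hbr]; lra. }
  assert (Hlen : b < a + 1).
  { apply Rnot_le_lt. intros H. pose proof (Hk a). pose proof (Hk (a + 1)).
    pose proof (g_shift a 1). lra. }
  (* a visit at time i is followed by an integer at time i + 1 *)
  pose (visits := fun u v i => exists q : Z, u < Nat.iter i g 0 + IZR q < v).
  assert (Hrestart : forall u v u' v' i j, a <= u -> v <= b -> (i < j)%nat ->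
     visits u v i -> visits u' v' j -> visits u' v' (j - i - 1)%nat).
  { intros u v u' v' i j Hu Hv Hij [q Hq] [q' Hq'].
    exists (k - q + q')%Z.
    assert (E : Nat.iter (S i) g 0 = 0 + IZR (k - q)).
    { simpl. replace (Nat.iter i g 0) with (Nat.iter i g 0 + IZR q + IZR (- q)) by (rewrite opp_IZR; lra).
      rewrite g_shift, Hk by lra. rewrite minus_IZR, opp_IZR. lra. }
    replace j with ((j - i - 1) + S i)%nat in Hq' by lia.
    rewrite iter_add, E in Hq'. unfold g in Hq'. rewrite (axisRe_iter_shift F HF) in Hq'.
    fold g in Hq'. rewrite plus_IZR. lra. }
  assert (Hone : forall s i j, (i + j <= s)%nat -> visits a ts i -> visits ts b j -> False).
  { induction s as [|s IH]; intros i j Hs Hi Hj.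
    - assert (i = j) as -> by lia. destruct Hi as [q Hq], Hj as [q' Hq'].
      assert (H : IZR q < IZR q') by lra. apply lt_IZR in H.
      assert (IZR q + 1 <= IZR q') by (rewrite <- plus_IZR; apply IZR_le; lia). lra.
    - destruct (lt_eq_lt_dec i j) as [[H|H]|H].
      + apply (IH i (j - i - 1)%nat); [lia|exact Hi|]. apply (Hrestart a ts ts b i j); auto; lra.
      + subst j. destruct Hi as [q Hq], Hj as [q' Hq'].
        assert (H : IZR q < IZR q') by lra. apply lt_IZR in H.
        assert (IZR q + 1 <= IZR q') by (rewrite <- plus_IZR; apply IZR_le; lia). lra.
      + apply (IH (i - j - 1)%nat j); [lia| |exact Hj]. apply (Hrestart ts b a ts j i); auto; lra. }
  pose (avoids := fun u v => forall i (q : Z), ~ (u < Nat.iter i g (IZR q) < v)).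
  assert (Hside : avoids a ts \/ avoids ts b).
  { destruct (classic (exists i, visits a ts i)) as [[i Hi]|Hno].
    - right. intros j q Hq. apply (Hone (i + j)%nat i j); [lia|exact Hi|]. exists q.
      replace (IZR q) with (0 + IZR q) in Hq by lra. unfold g in Hq.
      rewrite (axisRe_iter_shift F HF) in Hq. exact Hq.
    - left. intros j q Hq. apply Hno. exists j, q.
      replace (IZR q) with (0 + IZR q) in Hq by lra. unfold g in Hq.
      rewrite (axisRe_iter_shift F HF) in Hq. exact Hq. }
  assert (Hbase : exists u v, lap top 1 u v /\ avoids u v).
  { destruct Hside as [H|H]; [exists a, ts|exists ts, b]; (split; [|exact H]); apply lap_one;
      try lra; [left|right]; lra. }
  assert (Hfree : forall u v, avoids u v -> no_int u v).
  { intros u v H t Ht [q ->]. apply (H 0%nat q). simpl. exact Ht. }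
  destruct (displacement_bound g) as [M [HM HMg]]; [apply axisRe_cont, HF|exact g_shift|].
  assert (Hall : forall j, (1 <= j)%nat -> exists u v, lap top j u v /\ avoids u v).
  { intros j Hj. induction Hj as [|j Hj (u & v & Hlap & Hav)]; [exact Hbase|].
    assert (Huv : u < v) by apply Hlap.
    destruct (lap_pull top j u v (u - M) (v + M) Hlap (Hfree u v Hav)) as (c & d & _ & _ & Hlap' & Hin).
    - lra.
    - left. pose proof (HMg (u - M)). pose proof (HMg (v + M)). lra.
    - exists c, d. split; [exact Hlap'|]. intros i q Hq. apply (Hav (S i) q). simpl. apply Hin, Hq. }
  intros n Hn. destruct (Hall (n - 1)%nat) as (u & v & Hlap & Hav); [lia|].
  destruct (int_below u) as [q Hq].
  assert (Hv : v <= IZR q + 1).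
  { apply Rnot_lt_le. intros H. apply (Hfree u v Hav (IZR q + 1)); [lra|].
    exists (q + 1)%Z. now rewrite plus_IZR. }
  replace n with (S (n - 1)) by lia.
  apply (lap_close top (n - 1) (u + IZR (- q - 1)) (v + IZR (- q - 1)) 0 ys).
  - apply lap_shift, Hlap.
  - apply (no_int_unit (-1)); rewrite minus_IZR, opp_IZR; lra.
  - lra.
  - lra.
  - right. rewrite minus_IZR, opp_IZR. unfold U. rewrite (proj1 (stem_0 F)). fold g U. lra.
  - right; right. rewrite minus_IZR, opp_IZR. unfold U. rewrite (proj1 (stem_0 F)). fold g. lra.
Qed.

(** g maps [zeta,x] over [zeta,zeta+1], which contains [zeta,x] and, up to a
translation, a side of a bump of height top; U covers [zeta,x].  The loops
leave the branch for [zeta,x], stay there m >= 1 steps, go to the bump and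
climb back, which takes m + 2 steps. *)
Lemma periods_of_repelling_side (top ts ys zeta x : R) :
  Y ts = top -> 0 < top <= 1 -> 0 <= ys <= top -> U ys <= zeta ->
  -1 <= zeta < 0 -> g zeta <= zeta -> (Y zeta = 0 \/ zeta = -1) ->
  zeta < x <= 0 -> zeta + 1 <= g x -> x < g 0 ->
  forall n, (3 <= n)%nat -> Per F n.
Proof.
  intros Hts Htop Hys HU Hz Hgz HYz Hx Hgx Hx0.
  assert (Hbase : exists a b, zeta <= a /\ b <= zeta + 1 /\ no_int a b /\ lap top 1 a b).
  { destruct (int_below (ts - zeta)) as [q Hq]. pose (t := ts + IZR (- q)).
    assert (Ht : zeta <= t < zeta + 1) by (unfold t; rewrite opp_IZR; lra).
    assert (HYt : Y t = top) by (unfold t; rewrite Y_shift; exact Hts).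
    destruct (Rle_dec t 0) as [Hneg|Hpos].
    - destruct (zero_between zeta x) as [e [He He0]]; [lra|lra|].
      destruct (Rle_dec e t) as [Het|Het].
      + destruct (climb_left e t) as (a & Ha & Ha0 & _); [lra|exact He0|lra|].
        exists a, t. split; [lra|]. split; [lra|]. split; [apply (no_int_unit (-1)); lra|].
        apply lap_one; [lra|left; lra].
      + destruct (climb_right e t) as (b & Hb & Hb0 & _); [lra|exact He0|lra|].
        exists t, b. split; [lra|]. split; [lra|]. split; [apply (no_int_unit (-1)); lra|].
        apply lap_one; [lra|right; lra].
    - destruct HYz as [HYz|HYz]; [|lra].
      destruct (climb_right (zeta + 1) t) as (b & Hb & Hb0 & _);
        [lra|rewrite (Y_shift zeta 1); exact HYz|lra|].
      exists t, b. split; [lra|]. split; [lra|]. split; [apply (no_int_unit 0); lra|].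
      apply lap_one; [lra|right; lra]. }
  assert (Hall : forall j, (2 <= j)%nat -> exists a b, zeta <= a /\ b <= x /\ no_int a b /\ lap top j a b).
  { assert (Hstep : forall j a b, zeta <= a -> b <= zeta + 1 -> no_int a b -> lap top j a b ->
       exists a b, zeta <= a /\ b <= x /\ no_int a b /\ lap top (S j) a b).
    { intros j a b Ha Hb Hni Hlap.
      destruct (lap_pull top j a b zeta x Hlap Hni) as (c & d & H1 & H2 & H3 & _); [lra|left; lra|].
      exists c, d. repeat split; try assumption; try apply H3. apply (no_int_unit (-1)); lra. }
    intros j Hj. induction Hj as [|j Hj (a & b & Ha & Hb & Hni & Hlap)].
    - destruct Hbase as (a & b & Ha & Hb & Hni & Hlap). apply (Hstep 1%nat a b); assumption.
    - apply (Hstep j a b); try assumption. lra. }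
  intros n Hn. destruct (Hall (n - 1)%nat) as (a & b & Ha & Hb & Hni & Hlap); [lia|].
  replace n with (S (n - 1)) by lia.
  assert (HU0 : U 0 = g 0) by apply (stem_0 F).
  apply (lap_close top (n - 1) a b 0 ys Hlap Hni); [lra|lra|right; lra|lra].
Qed.

End Laps.

(** * Leaving the branch for the axis next to it *)

Lemma continuity_Rmax (f1 f2 : R -> R) :
  continuity f1 -> continuity f2 -> continuity (fun x => Rmax (f1 x) (f2 x)).
Proof.
  intros H1 H2 x.
  apply (continuity_pt_ext (fun t => (f1 t + f2 t + Rabs (f1 t - f2 t)) * / 2)).
  - intros t. unfold Rmax, Rabs. destruct (Rle_dec _ _), (Rcase_abs _); lra.
  - apply continuity_pt_mult; [|apply continuity_pt_const; intros u v; reflexivity].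
    apply continuity_pt_plus; [apply continuity_pt_plus; [apply H1|apply H2]|].
    apply (continuity_pt_comp (fun t => f1 t - f2 t) Rabs).
    + apply continuity_pt_minus; [apply H1|apply H2].
    + apply Rcontinuity_abs.
Qed.

Section Climb.
Context (F : C -> C) (HF : L1 F).
Let g := axisRe F.
Let Y := axisIm F.
Let U := stemRe F.
Let h := stemIm F.

(** The arc made of the branch over 0 (for t >= 0) and of the axis on its right
(for t <= 0). *)
Definition arm (t : R) : C := (Rmax 0 (- t), clamp01 t).
(** The retraction of the space onto the arc at k, read in the parameter of
[arm].  Branches not over k contribute no height, since heights are at most 1
and distances to k at least 1. *)
Definition arm_coord (k : Z) (z : C) : R :=
  Rmax 0 (snd z - Rabs (fst z - IZR k)) - Rmax 0 (fst z - IZR k).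

Lemma arm_S t : Sspace (arm t).
Proof.
  unfold arm. destruct (Rle_dec 0 t) as [H|H].
  - rewrite Rmax_left by lra. apply Sspace_stem, clamp01_range.
  - replace (clamp01 t) with 0; [apply Sspace_axis|].
    unfold clamp01, Rmax, Rmin. repeat destruct (Rle_dec _ _); lra.
Qed.

Lemma arm_up t : 0 <= t <= 1 -> arm t = (0, t).
Proof. intros H. unfold arm. rewrite Rmax_left by lra. now rewrite clamp01_id. Qed.

Lemma arm_right t : t <= 0 -> arm t = (- t, 0).
Proof.
  intros H. unfold arm. rewrite Rmax_right by lra. f_equal.
  unfold clamp01, Rmax, Rmin. repeat destruct (Rle_dec _ _); lra.
Qed.

Lemma arm_coord_up (k : Z) (y : R) : 0 <= y -> arm_coord k (IZR k, y) = y.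
Proof.
  intros Hy. unfold arm_coord. simpl. rewrite Rminus_diag, Rabs_R0, Rminus_0_r.
  rewrite Rmax_right by lra. rewrite Rmax_left by lra. lra.
Qed.

Lemma int_abs_ge1 (x : R) : is_int x -> x <> 0 -> x <= -1 \/ 1 <= x.
Proof.
  intros [k ->] Hx. assert (k <> 0)%Z by (intros ->; auto).
  destruct (Z_lt_le_dec k 0); [left|right]; apply IZR_le; lia.
Qed.

(** Coordinate 0 gathers the branching point and all that lies on its left. *)
Lemma arm_coord_cases (k : Z) (z : C) : Sspace z ->
  (0 < arm_coord k z /\ z = (IZR k, arm_coord k z)) \/
  (arm_coord k z < 0 /\ IZR k < fst z /\ arm_coord k z = IZR k - fst z) \/
  (arm_coord k z = 0 /\ (z = (IZR k, 0) \/ fst z < IZR k)).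
Proof.
  intros HS. destruct (Sspace_inv z HS) as [Hr Hint]. destruct z as [x y]. simpl in *.
  unfold arm_coord. simpl.
  destruct (Req_dec x (IZR k)) as [->|Hx].
  - rewrite Rminus_diag, Rabs_R0, Rminus_0_r. rewrite (Rmax_right 0 y) by lra.
    rewrite Rmax_left by lra. destruct (Req_dec y 0) as [->|Hy].
    + right; right. split; [lra|left; reflexivity].
    + left. split; [lra|]. f_equal. lra.
  - assert (Hzero : y - Rabs (x - IZR k) <= 0).
    { destruct (Req_dec y 0) as [->|Hy].
      - pose proof (Rabs_pos (x - IZR k)). lra.
      - destruct (int_abs_ge1 (x - IZR k)) as [H|H].
        + apply is_int_minus; [apply Hint; lra|exists k; reflexivity].
        + lra.
        + rewrite Rabs_left1; lra.
        + rewrite Rabs_right; lra. }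
    rewrite (Rmax_left 0 (y - _)) by exact Hzero.
    destruct (Rle_dec x (IZR k)).
    + rewrite Rmax_left by lra. right; right. split; [lra|]. right; lra.
    + rewrite Rmax_right by lra. right; left. lra.
Qed.

(** The retraction Phi of F to the arc satisfies Phi (- tr) <= b, w <= Phi b and
Phi w <= - tr, so it has an n-cycle, all of whose points but one are heights
at least b.  This is an orbit of F, unless the remaining point is 0 and is
reached by retracting a point on its left.  In that case the n-th iterate
moves 0 to the left and tl to the right (translations apart), and fixes a point
s between them; take s closest to 0.  If s came back after j < n steps, some r
in (s,0) would be at the branching point at time j, because 0 is then on the
branch; but at time n this r is over the branching point, so it has moved to the
right, against the choice of s. *)
Lemma periods_of_right_exit (k : Z) (tl tr w b : R) :
  g 0 = IZR k -> 0 < Y 0 ->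
  -1 < tl < 0 -> g tl = IZR k -> Y tl = 0 -> 0 < tr < 1 -> g tr = IZR k -> Y tr = 0 ->
  w <= 1 -> U w = IZR k + tr -> 0 < b < w -> U b = IZR k -> w <= h b ->
  forall n, (2 <= n)%nat -> Per F n.
Proof.
  intros Hg0 HY0 Htl Hgtl HYtl Htr Hgtr HYtr Hw HUw Hb HUb Hhb n Hn.
  pose (Phi := fun t => arm_coord k (F (arm t))).
  assert (HPhi : continuity Phi).
  { destruct (cont_step F HF (fun t => Rmax 0 (- t)) clamp01) as [H1 H2].
    - apply continuity_Rmax; [apply continuity_const; intros u v; reflexivity|].
      apply continuity_opp, derivable_continuous, derivable_id.
    - apply clamp01_cont.
    - apply arm_S.
    - assert (H3 : continuity (fun t => fst (F (arm t)) - IZR k)).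
      { apply continuity_minus; [exact H1|apply continuity_const; intros u v; reflexivity]. }
      apply continuity_minus; apply continuity_Rmax; try (apply continuity_const; intros u v; reflexivity).
      + apply continuity_minus; [exact H2|].
        apply (continuity_comp (fun t => fst (F (arm t)) - IZR k) Rabs); [exact H3|apply Rcontinuity_abs].
      + exact H3. }
  assert (HFtr : F (tr, 0) = (IZR k, 0)) by (rewrite axis_step; f_equal; assumption).
  assert (HFtl : F (tl, 0) = (IZR k, 0)) by (rewrite axis_step; f_equal; assumption).
  assert (Ha : Phi (- tr) = 0).
  { unfold Phi. rewrite arm_right by lra. rewrite Ropp_involutive, HFtr. apply arm_coord_up. lra. }
  assert (Hhw : h w = 0).
  { destruct (stemIm_range F HF w) as [[H|H] _]; [|symmetry; exact H].
    exfalso. apply (not_int_between k (U w)); [lra|]. apply stem_int; assumption. }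
  destruct (li_yorke Phi (- tr) b w n HPhi) as (x & Hx & Hfix & Hloc); try lra.
  { unfold Phi. rewrite arm_up by lra. rewrite (stem_step F) by lra. fold (U b) (h b).
    rewrite HUb, arm_coord_up by lra. exact Hhb. }
  { unfold Phi. rewrite arm_up by lra. rewrite (stem_step F) by lra. fold (U w) (h w).
    rewrite HUw, Hhw. unfold arm_coord. simpl.
    replace (IZR k + tr - IZR k) with tr by lra.
    rewrite (Rmax_right 0 tr) by lra. rewrite Rabs_right by lra. rewrite Rmax_left by lra. lra. }
  { exact Hn. }
  assert (Hmid : forall j, (1 <= j < n)%nat ->
     Nat.iter j F (arm x) = translate (k * Z.of_nat j) (0, Nat.iter j Phi x)).
  { intros j Hj. induction j as [|j IH]; [lia|].
    assert (Hpos : 0 < Nat.iter (S j) Phi x) by (specialize (Hloc (S j) Hj); lra).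
    assert (Hprev : exists m, Nat.iter j F (arm x) = translate (k * Z.of_nat j) m /\ Sspace m /\
                     Nat.iter (S j) Phi x = arm_coord k (F m)).
    { destruct j as [|j].
      - exists (arm x). rewrite Z.mul_0_r, translate_0. repeat split. apply arm_S.
      - exists (0, Nat.iter (S j) Phi x). specialize (Hloc (S j)).
        assert (b <= Nat.iter (S j) Phi x <= w) by (apply Hloc; lia).
        split; [apply IH; lia|]. split; [apply Sspace_stem; lra|].
        change (Phi (Nat.iter (S j) Phi x) = arm_coord k (F (0, Nat.iter (S j) Phi x))).
        unfold Phi at 1. rewrite arm_up by lra. reflexivity. }
    destruct Hprev as (m & E1 & E2 & E3).
    change (Nat.iter (S j) F (arm x)) with (F (Nat.iter j F (arm x))).
    rewrite E1, (F_shift F HF) by exact E2.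
    destruct (arm_coord_cases k (F m)) as [[H1 H2]|[H|H]]; [apply F_S; assumption| |lra|lra].
    rewrite <- E3 in H2. rewrite H2. unfold translate. simpl fst. simpl snd. f_equal.
    rewrite Nat2Z.inj_succ, Z.mul_succ_r, plus_IZR. lra. }
  pose (y := Nat.iter (n - 1) Phi x).
  assert (Hy : b <= y <= w) by (apply Hloc; lia).
  assert (Hlast : Nat.iter n F (arm x) = translate (k * Z.of_nat (n - 1)) (F (0, y))).
  { rewrite iter_pred, Hmid by lia.
    apply (F_shift F HF), Sspace_stem. lra. }
  assert (Hxy : arm_coord k (F (0, y)) = x).
  { transitivity (Nat.iter n Phi x); [|exact Hfix]. rewrite iter_pred by lia. fold y. unfold Phi.
    rewrite arm_up by lra. reflexivity. }
  assert (HSy : Sspace (F (0, y))) by (apply F_S; [exact HF|apply Sspace_stem; lra]).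
  assert (Hk : IZR (k * Z.of_nat (n - 1)) + IZR k = IZR (k * Z.of_nat n)).
  { rewrite <- plus_IZR. f_equal. lia. }
  destruct (arm_coord_cases k (F (0, y)) HSy) as [[H1 H2]|[(H1 & H2 & H3)|[H1 H2]]]; rewrite Hxy in *.
  - (* the orbit closes inside the branch *)
    apply (per_of_stem F HF x n); [lra|lia| |].
    + rewrite <- (arm_up x) by lra. rewrite Hlast, H2. reflexivity.
    + intros j Hj. rewrite <- (arm_up x) by lra. rewrite Hmid by exact Hj. simpl.
      specialize (Hloc j Hj). lra.
  - (* the orbit closes on the right arm *)
    assert (Hxne : x <> - tr).
    { intros ->. specialize (Hloc 1%nat). simpl in Hloc. rewrite Ha in Hloc.
      assert (b <= 0 <= w) by (apply Hloc; lia). lra. }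
    assert (Hreal : snd (F (0, y)) = 0).
    { destruct (Sspace_inv _ HSy) as [[[H|H] _] Hint]; [|symmetry; exact H].
      exfalso. apply (not_int_between k (fst (F (0, y)))); [lra|auto]. }
    apply (per_intro F (arm x) n); [apply arm_S|lia| | |].
    + rewrite Hlast, (arm_right x) by lra. exact Hreal.
    + rewrite Hlast, (arm_right x) by lra. simpl fst.
      exists (k * Z.of_nat n)%Z. lra.
    + intros j Hj Hs. rewrite Hmid in Hs by exact Hj. rewrite (arm_right x) in Hs by lra.
      simpl in Hs. specialize (Hloc j Hj). lra.
  - (* the orbit of the branching point comes back to it, or to its left *)
    assert (Harm0 : arm x = (0, 0)) by (rewrite H1; apply arm_up; lra).
    rewrite Harm0 in Hmid, Hlast.
    destruct H2 as [H2|H2].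
    { apply (per_intro F (0, 0) n); [apply Sspace_axis|lia| | |].
      - rewrite Hlast, H2. reflexivity.
      - rewrite Hlast, H2. simpl. exists (k * Z.of_nat n)%Z. lra.
      - intros j Hj Hs. rewrite Hmid in Hs by exact Hj. simpl in Hs. specialize (Hloc j Hj). lra. }
    pose (f := fun t => t - (fst (Nat.iter n F (t, 0)) - IZR (k * Z.of_nat n))).
    assert (Hf : continuity f).
    { apply continuity_minus; [apply derivable_continuous, derivable_id|].
      apply continuity_minus; [apply (cont_axis F HF n)|apply continuity_const; intros u v; reflexivity]. }
    assert (Hback : forall j, (1 <= j < n)%nat -> forall s q, Nat.iter j F (s, 0) = translate q (0, 0) ->
      q = (k * Z.of_nat j)%Z -> fst (Nat.iter n F (s, 0)) = IZR (k * Z.of_nat n)).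
    { intros j Hj s q Hs Hq. replace (Nat.iter n F (s, 0)) with (Nat.iter ((n - j) + j) F (s, 0)) by (f_equal; lia).
      rewrite iter_add, Hs.
      rewrite (iter_shift F HF) by apply Sspace_axis. rewrite Hmid by lia.
      rewrite translate_translate. unfold translate. simpl. rewrite Hq, Rplus_0_l. f_equal. lia. }
    assert (Hend : fst (Nat.iter n F (tl, 0)) = IZR (k * Z.of_nat n)).
    { apply (Hback 1%nat ltac:(lia) tl k); [|lia]. simpl. rewrite HFtl.
      unfold translate. simpl. f_equal. lra. }
    destruct (last_le f tl 0 0 Hf) as (s & Hs & Hfs & Hafter).
    + lra.
    + unfold f. rewrite Hend. lra.
    + unfold f. rewrite Hlast. unfold translate. simpl. lra.
    + assert (Hs0 : s <> 0).
      { intros ->. unfold f in Hfs. rewrite Hlast in Hfs. unfold translate in Hfs. simpl in Hfs. lra. }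
      assert (Hstl : s <> tl) by (intros ->; unfold f in Hfs; rewrite Hend in Hfs; lra).
      assert (Hnonint : forall q : Z, ~ is_int (s + IZR q)).
      { intros q. apply (not_int_between (q - 1)). rewrite minus_IZR. lra. }
      assert (HSn : Sspace (Nat.iter n F (s, 0))) by (apply iter_S; [exact HF|apply Sspace_axis]).
      apply (per_intro F (s, 0) n); [apply Sspace_axis|lia| | |].
      * destruct (Sspace_inv _ HSn) as [[[H|H] _] Hint]; [|symmetry; exact H].
        exfalso. apply (Hnonint (k * Z.of_nat n)%Z). unfold f in Hfs.
        replace (s + IZR (k * Z.of_nat n)) with (fst (Nat.iter n F (s, 0))) by lra. auto.
      * unfold f in Hfs. simpl. exists (k * Z.of_nat n)%Z. lra.
      * intros j Hj Hsj [q Hq]. simpl in Hsj, Hq.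
        destruct (last_le (fun t => snd (Nat.iter j F (t, 0))) s 0 0) as (r & Hr & Hr0 & Hrafter).
           ++ apply cont_axis, HF.
           ++ lra.
           ++ lra.
           ++ rewrite Hmid by exact Hj. simpl. specialize (Hloc j Hj). lra.
           ++ assert (Hrne : r <> 0).
              { intros ->. rewrite Hmid in Hr0 by exact Hj. simpl in Hr0. specialize (Hloc j Hj). lra. }
              destruct (int_valued_const (fun t => fst (Nat.iter j F (t, 0))) r 0) as [c Hc].
              ** apply cont_axis, HF.
              ** lra.
              ** intros t Ht. apply (Sspace_inv (Nat.iter j F (t, 0))).
                 --- apply iter_S; [exact HF|apply Sspace_axis].
                 --- apply Hrafter. lra.
              ** assert (Hck : c = (k * Z.of_nat j)%Z).
                 { apply eq_IZR. rewrite <- (Hc 0) by lra. rewrite Hmid by exact Hj. simpl. lra. }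
                 assert (Hrs : r <> s).
                 { intros ->. rewrite (Hc s) in Hq by lra.
                   apply (Hnonint q). exists c. lra. }
                 assert (Hbad : fst (Nat.iter n F (r, 0)) = IZR (k * Z.of_nat n)).
                 { apply (Hback j Hj r c); [|exact Hck].
                   rewrite (surjective_pairing (Nat.iter j F (r, 0))). rewrite Hc by lra.
                   rewrite Hr0. unfold translate. simpl. f_equal. lra. }
                 specialize (Hafter r ltac:(lra)). unfold f in Hafter. rewrite Hbad in Hafter. lra.
Qed.

End Climb.

(** * Mirror images *)

Definition refl (z : C) : C := (- fst z, snd z).
Definition mirror (F : C -> C) (z : C) : C := refl (F (refl z)).

Lemma refl_refl z : refl (refl z) = z.
Proof. destruct z. unfold refl. simpl. now rewrite Ropp_involutive. Qed.

Lemma refl_S z : Sspace z -> Sspace (refl z).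
Proof.
  intros [H|[[k H] H']]; [left; exact H|right; split; [|exact H']].
  exists (- k)%Z. unfold refl, Re in *. simpl. rewrite H. now rewrite opp_IZR.
Qed.

Lemma mirror_iter F n z : Nat.iter n (mirror F) z = refl (Nat.iter n F (refl z)).
Proof.
  induction n as [|n IH]; simpl; [now rewrite refl_refl|].
  rewrite IH. unfold mirror. now rewrite refl_refl.
Qed.

Lemma mirror_L1 F : L1 F -> L1 (mirror F).
Proof.
  intros HF. assert (HF' := HF). destruct HF' as (H1 & H2 & H3). split; [|split].
  - intros z Hz. apply refl_S, H1, refl_S, Hz.
  - intros z Hz.
    apply (filterlim_comp _ _ _ (fun z => F (refl z)) refl _ (locally (F (refl z)))).
    + apply (filterlim_comp _ _ _ refl F _ (within Sspace (locally (refl z)))); [|apply H2, refl_S, Hz].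
      intros P [eps HP]. exists eps. intros w [B1 B2] Hw. apply HP; [|apply refl_S, Hw].
      split; [|exact B2]. unfold refl. simpl.
      unfold ball in *. simpl in *. unfold AbsRing_ball, abs, minus, plus, opp in *. simpl in *.
      rewrite <- Rabs_Ropp. replace (- (- fst w + - - fst z)) with (fst w + - fst z) by lra. exact B1.
    + apply filterlim_locally. intros eps. exists eps. intros w [B1 B2].
      split; [|exact B2]. unfold refl. simpl.
      unfold ball in *. simpl in *. unfold AbsRing_ball, abs, minus, plus, opp in *. simpl in *.
      rewrite <- Rabs_Ropp.
      replace (- (- fst w + - - fst (F (refl z)))) with (fst w + - fst (F (refl z))) by lra. exact B1.
  - intros z Hz. rewrite (translate_add 1 (mirror F z)), (translate_add 1 z). unfold mirror.
    replace (refl (translate 1 z)) with (translate (-1) (refl z)).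
    + rewrite (F_shift F HF) by apply refl_S, Hz. unfold refl, translate. simpl. f_equal. lra.
    + unfold refl, translate. simpl. f_equal. lra.
Qed.

Lemma mirror_per F n : Per (mirror F) n -> Per F n.
Proof.
  assert (Hret : forall z m, returns_mod1 (mirror F) z m <-> returns_mod1 F (refl z) m).
  { intros z m. split; intros [k Hk]; exists (- k)%Z.
    - rewrite mirror_iter, translate_add in Hk. rewrite translate_add.
      rewrite <- (refl_refl (Nat.iter m F (refl z))), Hk.
      unfold refl, translate. simpl. rewrite opp_IZR. f_equal. lra.
    - rewrite translate_add in Hk. rewrite mirror_iter, translate_add, Hk.
      unfold refl, translate. simpl. rewrite opp_IZR. f_equal. lra. }
  intros (z & Hz & Hn & Hr & Hmin). exists (refl z).
  split; [apply refl_S, Hz|]. split; [exact Hn|]. split; [apply Hret, Hr|].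
  intros m Hm Hm'. apply Hmin; [exact Hm|]. apply Hret, Hm'.
Qed.

Lemma mirror_axis F x :
  axisRe (mirror F) x = - axisRe F (- x) /\ axisIm (mirror F) x = axisIm F (- x).
Proof. split; reflexivity. Qed.

Lemma mirror_stem F y : stemRe (mirror F) y = - stemRe F y /\ stemIm (mirror F) y = stemIm F y.
Proof.
  unfold stemRe, stemIm, mirror, refl. simpl. rewrite Ropp_0. split; reflexivity.
Qed.

(** * Barriers and heights *)

Definition goes_down (F : C -> C) : Prop :=
  exists x, forall M, exists N : nat, forall n, (N <= n)%nat -> fst (Nat.iter n F (x, 0)) < M.
Definition goes_up (F : C -> C) : Prop :=
  exists x, forall M, exists N : nat, forall n, (N <= n)%nat -> M < fst (Nat.iter n F (x, 0)).

Lemma mirror_down F : goes_up F -> goes_down (mirror F).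
Proof.
  intros [x H]. exists (- x). intros M. destruct (H (- M)) as [N HN]. exists N. intros n Hn.
  rewrite mirror_iter. unfold refl at 2. simpl. rewrite Ropp_involutive. specialize (HN n Hn). lra.
Qed.

Lemma mirror_up F : goes_down F -> goes_up (mirror F).
Proof.
  intros [x H]. exists (- x). intros M. destruct (H (- M)) as [N HN]. exists N. intros n Hn.
  rewrite mirror_iter. unfold refl at 2. simpl. rewrite Ropp_involutive. specialize (HN n Hn). lra.
Qed.

Lemma mirror_lower F z : upper_barrier (axisRe F) z -> lower_barrier (axisRe (mirror F)) (- z).
Proof. intros H s Hs. rewrite (proj1 (mirror_axis F s)). specialize (H (- s)). lra. Qed.

Lemma mirror_upper F z : lower_barrier (axisRe F) z -> upper_barrier (axisRe (mirror F)) (- z).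
Proof. intros H s Hs. rewrite (proj1 (mirror_axis F s)). specialize (H (- s)). lra. Qed.

Definition peak (F : C -> C) (top : R) : Prop :=
  (forall x, axisIm F x <= top) /\ exists t, axisIm F t = top.

(** Orbits that start on the axis never exceed the height hull.  Its minimality
is what makes heights in (top,hull] reachable from below, see [hull_reach]. *)
Definition stem_hull (F : C -> C) (top hull : R) : Prop :=
  top <= hull <= 1 /\ (forall y, 0 <= y <= hull -> stemIm F y <= hull) /\
  (forall y, top <= y <= 1 -> (forall s, 0 <= s <= y -> stemIm F s <= y) -> hull <= y).

Lemma mirror_peak F top : peak F top -> peak (mirror F) top.
Proof.
  intros [H1 [t Ht]]. split.
  - intros x. rewrite (proj2 (mirror_axis F x)). apply H1.
  - exists (- t). rewrite (proj2 (mirror_axis F _)), Ropp_involutive. exact Ht.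
Qed.

Lemma mirror_hull F top hull : stem_hull F top hull -> stem_hull (mirror F) top hull.
Proof.
  intros (H1 & H2 & H3). split; [exact H1|]. split.
  - intros y Hy. rewrite (proj2 (mirror_stem F y)). apply H2, Hy.
  - intros y Hy H. apply H3; [exact Hy|]. intros s Hs. rewrite <- (proj2 (mirror_stem F s)). apply H, Hs.
Qed.

Section Cases.
Context (F : C -> C) (HF : L1 F).
Let g := axisRe F.
Let Y := axisIm F.
Let U := stemRe F.
Let h := stemIm F.

Lemma peak_exists : exists top, peak F top /\ 0 <= top <= 1.
Proof.
  destruct (continuity_ab_maj Y 0 1) as [M [HM HM']]; [lra|intros; apply axisIm_cont, HF|].
  exists (Y M). split; [|apply axisIm_range, HF]. split; [|exists M; reflexivity].
  intros x. destruct (int_below x) as [k Hk].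
  replace x with (x - IZR k + IZR k) by lra. fold Y. unfold Y. rewrite (proj2 (axis_shift F HF k _)).
  apply HM. lra.
Qed.

Lemma hull_exists top : 0 <= top <= 1 -> exists hull, stem_hull F top hull.
Proof.
  intros Htop.
  destruct (glb_exists (fun y => top <= y <= 1 /\ forall s, 0 <= s <= y -> h s <= y) top 1) as [m [Hm1 Hm2]].
  - split; [lra|]. intros s _. apply stemIm_range, HF.
  - intros y [Hy _]; lra.
  - exists m. split; [|split].
    + split.
      * apply Rnot_lt_le. intros H. destruct (Hm2 (top - m)) as [y [[Hy _] Hy']]; lra.
      * apply Hm1. split; [lra|]. intros s _. apply stemIm_range, HF.
    + intros y Hy. apply Rnot_lt_le. intros H.
      destruct (Hm2 (h y - m)) as [e [[He He'] He'']]; [unfold h; lra|].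
      specialize (Hm1 e (conj He He')). specialize (He' y). unfold h in *. lra.
    + intros y Hy H. apply Hm1. split; assumption.
Qed.

Lemma Sspace_cases z : Sspace z -> z = (fst z, 0) \/ (0 < snd z <= 1 /\ exists k, z = translate k (0, snd z)).
Proof.
  intros HS. destruct (Sspace_inv z HS) as [H1 H2]. destruct z as [x y]. simpl in *.
  destruct (Req_dec y 0) as [->|Hy]; [left; reflexivity|right]. split; [lra|].
  destruct H2 as [k ->]; [lra|]. exists k. unfold translate. simpl. f_equal. lra.
Qed.

Context (top hull : R) (Hpeak : peak F top) (Hhull : stem_hull F top hull).

Lemma top_range : 0 <= top <= 1.
Proof. destruct (proj2 Hpeak) as [t Ht]. rewrite <- Ht. apply axisIm_range, HF. Qed.

(** If the branches of height at most hull standing over P were also sent over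
P, no orbit could leave P. *)
Lemma escape (P : R -> Prop) :
  (forall x, P x -> P (g x)) -> (exists x n, P x /\ ~ P (fst (Nat.iter n F (x, 0)))) ->
  exists (k : Z) y, P (IZR k) /\ 0 <= y <= hull /\ ~ P (U y + IZR k).
Proof.
  intros HP (x & n & Hx & Hn). apply NNPP. intros Hno.
  destruct Hhull as (Hb & Hinv & _). pose proof top_range as Htop.
  assert (Hstep : forall z, Sspace z /\ P (fst z) /\ snd z <= hull ->
                    Sspace (F z) /\ P (fst (F z)) /\ snd (F z) <= hull).
  { intros z (HS & HPz & Hz). split; [apply F_S; assumption|].
    destruct (Sspace_cases z HS) as [E|[Hpos [k E]]].
    - rewrite E, axis_step. simpl. split; [apply HP, HPz|].
      pose proof (proj1 Hpeak (fst z)). lra.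
    - assert (HPk : P (IZR k)) by (rewrite E in HPz; simpl in HPz; rewrite Rplus_0_l in HPz; exact HPz).
      rewrite E, (F_shift F HF) by (apply Sspace_stem; lra).
      rewrite (stem_step F) by lra. simpl. split; [|apply Hinv; lra].
      apply NNPP. intros Hbad. apply Hno. exists k, (snd z). split; [exact HPk|]. split; [lra|exact Hbad]. }
  assert (Hall : forall m, Sspace (Nat.iter m F (x, 0)) /\ P (fst (Nat.iter m F (x, 0))) /\
                  snd (Nat.iter m F (x, 0)) <= hull).
  { intros m. induction m as [|m IH]; simpl.
    - split; [apply Sspace_axis|]. split; [exact Hx|]. lra.
    - apply Hstep, IH. }
  apply Hn, Hall.
Qed.

Lemma iter_axis_shift (n : nat) (x : R) (k : Z) :
  fst (Nat.iter n F (x + IZR k, 0)) = fst (Nat.iter n F (x, 0)) + IZR k.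
Proof.
  change (x + IZR k, 0) with (translate k (x, 0)). rewrite (iter_shift F HF) by apply Sspace_axis. reflexivity.
Qed.

Lemma escape_below (z : R) :
  goes_down F -> lower_barrier g z -> -1 < z <= 0 -> exists y, 0 <= y <= hull /\ U y < z.
Proof.
  intros [x Hx] Hbar Hz.
  destruct (escape (fun t => z <= t)) as (k & y & Hk & Hy & HU).
  - intros t Ht. apply Hbar, Ht.
  - destruct (int_left (z - x)) as [q Hq].
    exists (x + IZR (q + 1)). destruct (Hx (z - IZR (q + 1))) as [N HN]. exists N.
    split; [rewrite plus_IZR; lra|]. rewrite iter_axis_shift. specialize (HN N (le_n N)). lra.
  - exists y. split; [exact Hy|]. apply Rnot_le_lt in HU.
    assert (-1 < k)%Z by (apply lt_IZR; lra). assert (0 <= IZR k) by (apply IZR_le; lia). lra.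
Qed.

Lemma escape_above (z : R) :
  goes_up F -> upper_barrier g z -> 0 <= z < 1 -> exists y, 0 <= y <= hull /\ z < U y.
Proof.
  intros [x Hx] Hbar Hz.
  destruct (escape (fun t => t <= z)) as (k & y & Hk & Hy & HU).
  - intros t Ht. apply Hbar, Ht.
  - destruct (int_below (z - x)) as [q Hq].
    exists (x + IZR q). destruct (Hx (z - IZR q)) as [N HN]. exists N.
    split; [lra|]. rewrite iter_axis_shift. specialize (HN N (le_n N)). lra.
  - exists y. split; [exact Hy|]. apply Rnot_le_lt in HU.
    assert (k < 1)%Z by (apply lt_IZR; lra). assert (IZR k <= 0) by (apply IZR_le; lia). lra.
Qed.

Lemma escape_strictly (c : R) :
  goes_up F -> (forall x, x < c -> g x < c) -> 0 < c <= 1 -> exists y, 0 <= y <= hull /\ c <= U y.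
Proof.
  intros [x Hx] Hbar Hz.
  destruct (escape (fun t => t < c)) as (k & y & Hk & Hy & HU).
  - intros t Ht. apply Hbar, Ht.
  - destruct (int_left (c - x)) as [q Hq].
    exists (x + IZR q). destruct (Hx (c - IZR q)) as [N HN]. exists N.
    split; [lra|]. rewrite iter_axis_shift. specialize (HN N (le_n N)). lra.
  - exists y. split; [exact Hy|]. apply Rnot_lt_le in HU.
    assert (k < 1)%Z by (apply lt_IZR; lra). assert (IZR k <= 0) by (apply IZR_le; lia). lra.
Qed.

(** Otherwise [0,w) is stable under h, and so is a closed part of it that
contains [0,top], against the minimality of hull. *)
Lemma hull_reach (w : R) : top < w <= hull -> h w = 0 -> exists b, 0 <= b < w /\ w <= h b.
Proof.
  intros Hw Hh. apply NNPP. intros Hno. pose proof top_range as Htop.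
  destruct Hhull as (Hb & _ & Hmin).
  assert (Hlt : forall s, 0 <= s <= w -> h s < w).
  { intros s Hs. destruct (Req_dec s w) as [->|Hne]; [lra|].
    apply Rnot_le_lt. intros H. apply Hno. exists s. split; [lra|exact H]. }
  destruct (continuity_ab_maj h 0 w) as [M [HM HM']]; [lra|intros; apply stemIm_cont, HF|].
  assert (HMw := Hlt M HM').
  assert (Hmax : top <= Rmax top (h M) < w) by (unfold Rmax; destruct (Rle_dec top (h M)); lra).
  assert (hull <= Rmax top (h M)); [|lra].
  apply Hmin; [lra|]. intros s Hs. apply Rle_trans with (h M); [apply HM; lra|apply Rmax_r].
Qed.

(** As long as heights stay positive, h describes F mod 1. *)
Lemma stem_cycle (e b w : R) (n : nat) :
  0 < e -> e < b -> b < w <= 1 -> h e <= b -> w <= h b -> h w <= e -> (1 <= n)%nat -> Per F n.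
Proof.
  intros He Heb Hbw H1 H2 H3 Hn.
  destruct (li_yorke_exact h e b w n) as (x & [Hfix Hne] & Hloc); try lra; try assumption;
    [apply stemIm_cont, HF|].
  assert (Hx : e <= x <= w) by (apply (Hloc 0%nat); lia).
  assert (Hpos : forall j, (j <= n)%nat -> e <= Nat.iter j h x <= w).
  { intros j Hj. destruct (Nat.eq_dec j n) as [->|Hjn]; [rewrite Hfix; exact Hx|apply Hloc; lia]. }
  assert (Horb : forall j, (j <= n)%nat -> exists k, Nat.iter j F (0, x) = translate k (0, Nat.iter j h x)).
  { intros j Hj. induction j as [|j IH].
    - exists 0%Z. now rewrite translate_0.
    - destruct IH as [k IH]; [lia|]. simpl. rewrite IH.
      pose proof (Hpos j ltac:(lia)) as Hp. pose proof (Hpos (S j) Hj) as Hp'. simpl in Hp'.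
      rewrite (F_shift F HF) by (apply Sspace_stem; lra). rewrite (stem_step F) by lra.
      destruct (stem_int F HF (Nat.iter j h x)) as [m Hm]; [fold h; lra|].
      exists (k + m)%Z. unfold translate. simpl. rewrite Hm, plus_IZR. f_equal. lra. }
  apply (per_of_stem F HF x n); [lra|exact Hn| |].
  - destruct (Horb n) as [k ->]; [lia|]. exact Hfix.
  - intros j Hj Hs. destruct (Horb j) as [k E]; [lia|]. rewrite E in Hs. apply (Hne j Hj), Hs.
Qed.

(** Otherwise the set formed by (tl,tr) and the branch up to hull is mapped into
its translate by k, and the barrier gives k >= 0: an orbit that enters a
translate of this set cannot go to -oo.  An orbit that never enters one stays
on the axis, where the barrier stops it. *)
Lemma exit_from_bump (z tl tr : R) (k : Z) :
  goes_down F -> lower_barrier g z -> -1 < z <= 0 -> -1 < tl < 0 -> 0 < tr < 1 ->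
  (forall t, tl <= t <= tr -> g t = IZR k) ->
  exists y, 0 <= y <= hull /\ (U y <= IZR k + tl \/ IZR k + tr <= U y).
Proof.
  intros [x Hx] Hbar Hz Htl Htr Hgk. apply NNPP. intros Hno.
  destruct Hhull as (Hb & Hinv & _). pose proof top_range as Htop.
  assert (Hk : (0 <= k)%Z).
  { assert (z <= IZR k) by (rewrite <- (Hgk 0) by lra; apply Hbar; lra).
    assert (-1 < k)%Z by (apply lt_IZR; lra). lia. }
  pose (Z0 := fun (m : Z) z => Sspace z /\ IZR m + tl < fst z < IZR m + tr /\ snd z <= hull).
  assert (Hstep : forall m z, Z0 m z -> Z0 (m + k)%Z (F z)).
  { intros m w (HS & Hr & Hw). split; [apply F_S; assumption|].
    destruct (Sspace_cases w HS) as [E|[Hpos [q E]]].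
    - rewrite E, axis_step. simpl. fold g.
      replace (fst w) with (fst w - IZR m + IZR m) by lra. unfold g.
      rewrite (proj1 (axis_shift F HF m _)), (proj2 (axis_shift F HF m _)). fold g.
      rewrite Hgk by lra. rewrite plus_IZR. pose proof (proj1 Hpeak (fst w - IZR m)). lra.
    - rewrite E in Hr. simpl in Hr. assert (q = m) as ->.
      { assert (q < m + 1)%Z by (apply lt_IZR; rewrite plus_IZR; lra).
        assert (m - 1 < q)%Z by (apply lt_IZR; rewrite minus_IZR; lra). lia. }
      rewrite E, (F_shift F HF) by (apply Sspace_stem; lra). rewrite (stem_step F) by lra. simpl.
      rewrite plus_IZR. split; [|apply Hinv; lra]. fold U.
      assert (~ (U (snd w) <= IZR k + tl \/ IZR k + tr <= U (snd w))); [|lra].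
      intros Hbad. apply Hno. exists (snd w). split; [lra|exact Hbad]. }
  assert (Hfree : forall i m, ~ Z0 m (Nat.iter i F (x, 0))).
  { intros i m Hi.
    assert (Hlater : forall j, exists q, (m <= q)%Z /\ Z0 q (Nat.iter (j + i) F (x, 0))).
    { induction j as [|j [q [Hq IH]]]; [exists m; split; [lia|exact Hi]|].
      exists (q + k)%Z. split; [lia|]. apply Hstep, IH. }
    destruct (Hx (IZR m + tl)) as [N HN]. destruct (Hlater N) as (q & Hq & _ & Hr & _).
    specialize (HN (N + i)%nat ltac:(lia)). apply IZR_le in Hq. lra. }
  assert (Hreal : forall i, Nat.iter i F (x, 0) = (Nat.iter i g x, 0)).
  { induction i as [|i IH]; [reflexivity|]. simpl. rewrite IH, axis_step.
    f_equal. destruct (axisIm_range F HF (Nat.iter i g x)) as [[H|H] _]; [|symmetry; exact H].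
    exfalso. destruct (axis_int F HF _ H) as [m Hm]. apply (Hfree (S i) m). simpl. rewrite IH.
    split; [apply F_S, Sspace_axis; exact HF|]. rewrite axis_step. simpl. rewrite Hm.
    pose proof (proj1 Hpeak (Nat.iter i g x)). lra. }
  destruct (int_below (x - z)) as [q Hq].
  assert (Hbar' : lower_barrier g (z + IZR q)) by (apply lower_shift; assumption).
  destruct (Hx (z + IZR q)) as [N HN]. specialize (HN N (le_n N)). rewrite Hreal in HN. simpl in HN.
  assert (Hge : forall i, z + IZR q <= Nat.iter i g x).
  { induction i as [|i IH]; simpl; [lra|]. apply Hbar', IH. }
  specialize (Hge N). lra.
Qed.

(** By [hull_reach] some b < w has h b >= w.  If h takes a value at most b at
some e in (0,b), then e, b, w is a triple of positive heights for h.  If not, 0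
itself climbs.  Let v be the first height at which U leaves the bump (tl,tr)
around 0.  It falls on the axis, at an end of a translate of the bump, and a lower height is
sent to v or above: this is the situation of [periods_of_right_exit] or its
mirror image. *)
Lemma periods_of_high_zero (z w : R) :
  goes_down F -> lower_barrier g z -> -1 < z <= 0 -> top < w <= hull -> h w = 0 ->
  forall n, (1 <= n)%nat -> Per F n.
Proof.
  intros Hdown Hbar Hz Hw Hhw n Hn. pose proof top_range as Htop.
  destruct (hull_reach w Hw Hhw) as (b & Hb & Hhb).
  destruct Hhull as (Hhl & _ & _).
  assert (Hh0 : h 0 = Y 0) by apply (stem_0 F).
  assert (Hh0' : h 0 <= top) by (rewrite Hh0; apply Hpeak).
  assert (Hb0 : 0 < b) by (destruct (Req_dec b 0) as [E|]; [rewrite E in Hhb; lra|lra]).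
  destruct (classic (exists e, 0 < e < b /\ h e <= b)) as [(e & He & Hhe)|Hno].
  { apply (stem_cycle e b w); lra || assumption. }
  assert (Hhigh : forall e, 0 < e < b -> b < h e).
  { intros e He. apply Rnot_le_lt. intros H. apply Hno. exists e. auto. }
  assert (HY0 : 0 < Y 0).
  { rewrite <- Hh0. apply Rlt_le_trans with b; [exact Hb0|]. apply Rnot_lt_le. intros H.
    destruct (sign_stable_lt h 0 b (stemIm_cont F HF) H) as [d [Hd Hnear]].
    specialize (Hnear (Rmin (d / 2) (b / 2))).
    assert (0 < Rmin (d / 2) (b / 2) <= d / 2 /\ Rmin (d / 2) (b / 2) <= b / 2)
      by (unfold Rmin; destruct (Rle_dec _ _); lra).
    rewrite Rabs_right in Hnear by lra. specialize (Hhigh (Rmin (d / 2) (b / 2))). lra. }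
  destruct (Nat.eq_dec n 1) as [->|Hn1].
  { apply (per_of_first_climb F HF 1); [lia| |exact HY0].
    intros i Hi. replace i with 0%nat by lia. reflexivity. }
  assert (Hg1 : g (0 + 1) = g 0 + 1) by apply (g_shift F HF 0 1).
  assert (Hg2 : g (0 + -1) = g 0 + -1) by apply (g_shift F HF 0 (-1)).
  assert (HY1 : Y (0 + 1) = Y 0) by apply (Y_shift F HF 0 1).
  assert (HY2 : Y (0 + -1) = Y 0) by apply (Y_shift F HF 0 (-1)).
  destruct (zero_between F HF (0 + -1) 0) as [e1 [He1 He1']]; [lra|fold g; lra|].
  destruct (zero_between F HF 0 (0 + 1)) as [e2 [He2 He2']]; [lra|fold g; lra|].
  destruct (climb_left F HF e1 0) as (tl & Htl & HYtl & Hal); [lra|exact He1'|exact HY0|].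
  destruct (climb_right F HF e2 0) as (tr & Htr & HYtr & Hbr); [lra|exact He2'|exact HY0|].
  destruct (const_of_climb F HF tl tr) as [k Hk]; [lra| |].
  { intros s Hs. destruct (Rle_dec s 0); [apply Hal|apply Hbr]; lra. }
  fold g in Hk. fold Y in HYtl, HYtr.
  destruct (exit_from_bump z tl tr k Hdown Hbar Hz) as (y & Hy & Hexit); [lra|lra|exact Hk|].
  assert (HU0 : U 0 = IZR k) by (rewrite <- (Hk 0) by lra; apply (stem_0 F)).
  (* phi < 1 expresses that U s stays over the bump *)
  pose (phi := fun s => Rmax ((U s - IZR k) * / tl) ((U s - IZR k) * / tr)).
  assert (Hphi : continuity phi).
  { apply continuity_Rmax; apply continuity_mult;
      try (apply continuity_const; intros u v; reflexivity);
      apply continuity_minus; try apply stemRe_cont, HF; apply continuity_const; intros u v; reflexivity. }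
  assert (Hphi_lt : forall s, phi s < 1 -> IZR k + tl < U s < IZR k + tr).
  { intros s Hs. unfold phi in Hs.
    pose proof (Rmax_l ((U s - IZR k) * / tl) ((U s - IZR k) * / tr)).
    pose proof (Rmax_r ((U s - IZR k) * / tl) ((U s - IZR k) * / tr)).
    assert (E1 : (U s - IZR k) * / tl * tl = U s - IZR k) by (field; lra).
    assert (E2 : (U s - IZR k) * / tr * tr = U s - IZR k) by (field; lra).
    nra. }
  assert (Hphi_eq : forall s, phi s = 1 -> U s = IZR k + tl \/ U s = IZR k + tr).
  { intros s Hs. unfold phi, Rmax in Hs.
    assert (E1 : (U s - IZR k) * / tl * tl = U s - IZR k) by (field; lra).
    assert (E2 : (U s - IZR k) * / tr * tr = U s - IZR k) by (field; lra).
    destruct (Rle_dec _ _); [right|left]; rewrite Hs in *; lra. }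
  destruct (first_ge phi 0 y 1 Hphi) as (v & Hv & Hv1 & Hvbefore).
  - lra.
  - unfold phi. rewrite HU0. rewrite Rminus_diag, !Rmult_0_l. rewrite Rmax_left; lra.
  - unfold phi. destruct Hexit as [H|H].
    + apply Rle_trans with ((U y - IZR k) * / tl); [|apply Rmax_l].
      replace ((U y - IZR k) * / tl) with ((IZR k - U y) * / (- tl)) by (field; lra).
      apply (Rmult_le_reg_r (- tl)); [lra|].
      replace ((IZR k - U y) * / - tl * - tl) with (IZR k - U y) by (field; lra). lra.
    + apply Rle_trans with ((U y - IZR k) * / tr); [|apply Rmax_r].
      apply (Rmult_le_reg_r tr); [lra|].
      replace ((U y - IZR k) * / tr * tr) with (U y - IZR k) by (field; lra). lra.
  - assert (Hv' := Hphi_eq v Hv1).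
    assert (Hhv : h v = 0).
    { destruct (stemIm_range F HF v) as [[H|H] _]; [|symmetry; exact H].
      exfalso. destruct Hv' as [H'|H'].
      - apply (not_int_between (k - 1) (U v)); [rewrite minus_IZR; lra|apply stem_int; assumption].
      - apply (not_int_between k (U v)); [lra|apply stem_int; assumption]. }
    assert (Hv0 : v <> 0) by (intros ->; lra).
    assert (Hbb : exists b', 0 < b' < v /\ v <= h b').
    { destruct (Rle_dec v w) as [Hvw|Hvw].
      - exists b. split; [|lra]. split; [exact Hb0|]. apply Rnot_le_lt. intros H.
        destruct (Req_dec v b) as [->|]; [lra|]. specialize (Hhigh v). lra.
      - destruct (hull_reach v) as (b' & Hb' & Hhb'); [lra|exact Hhv|].
        exists b'. split; [|exact Hhb']. split; [|lra].
        destruct (Req_dec b' 0) as [E|]; [rewrite E in Hhb'; lra|lra]. }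
    destruct Hbb as (b' & Hb' & Hhb').
    assert (HUb' : U b' = IZR k).
    { assert (Hr := Hphi_lt b' (Hvbefore b' ltac:(lra))).
      destruct (stem_int F HF b') as [m Hm]; [fold h; lra|]. fold U in Hm. rewrite Hm in *.
      assert (m < k + 1)%Z by (apply lt_IZR; rewrite plus_IZR; lra).
      assert (k - 1 < m)%Z by (apply lt_IZR; rewrite minus_IZR; lra). f_equal. lia. }
    destruct Hv' as [HUv|HUv].
    + apply mirror_per.
      apply (periods_of_right_exit (mirror F) (mirror_L1 F HF) (- k) (- tr) (- tl) v b');
        rewrite ?(proj1 (mirror_axis F _)), ?(proj2 (mirror_axis F _)),
                ?(proj1 (mirror_stem F _)), ?(proj2 (mirror_stem F _)), ?Ropp_involutive, ?Ropp_0, ?opp_IZR;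
        fold g Y U h; try lra; try lia; try (f_equal; apply Hk; lra); try assumption.

    + apply (periods_of_right_exit F HF k tl tr v b'); fold g Y U h; try lra; try lia; try (apply Hk; lra); assumption.
Qed.

End Cases.

(** * Periods in the presence of barriers *)

Section Assembly.
Context (F : C -> C) (HF : L1 F).
Let g := axisRe F.
Let Y := axisIm F.
Let U := stemRe F.
Let h := stemIm F.
Context (top hull : R) (Hpeak : peak F top) (Hhull : stem_hull F top hull).
Context (Hflat : forall w, top < w <= hull -> stemIm F w <> 0).

(** No height in (top,hull] falls to the axis, so U is integer valued there and
hence constant. *)
Lemma reach_low (y : R) : 0 <= y <= hull -> exists y', 0 <= y' <= top /\ U y' = U y.
Proof.
  intros Hy. destruct (Rle_dec y top) as [Hle|Hgt]; [exists y; split; [lra|reflexivity]|].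
  pose proof (top_range F HF top Hpeak) as Htop.
  exists top. split; [lra|].
  destruct (int_valued_const U top y) as [k Hk]; [apply stemRe_cont, HF|lra| |].
  - intros t Ht. apply stem_int; [exact HF|].
    destruct (stemIm_range F HF t) as [[H|H] _]; [exact H|]. exfalso. apply (Hflat t); lra.
  - rewrite !Hk by lra. reflexivity.
Qed.

Lemma low_below (z : R) :
  goes_down F -> lower_barrier g z -> -1 < z <= 0 -> exists y, 0 <= y <= top /\ U y < z.
Proof.
  intros H1 H2 H3. destruct (escape_below F HF top hull Hpeak Hhull z H1 H2 H3) as (y & Hy & HU).
  destruct (reach_low y Hy) as (y' & Hy' & E). exists y'. split; [exact Hy'|]. rewrite E. exact HU.
Qed.

Lemma low_above (z : R) :
  goes_up F -> upper_barrier g z -> 0 <= z < 1 -> exists y, 0 <= y <= top /\ z < U y.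
Proof.
  intros H1 H2 H3. destruct (escape_above F HF top hull Hpeak Hhull z H1 H2 H3) as (y & Hy & HU).
  destruct (reach_low y Hy) as (y' & Hy' & E). exists y'. split; [exact Hy'|]. rewrite E. exact HU.
Qed.

Lemma low_strictly (c : R) :
  goes_up F -> (forall x, x < c -> g x < c) -> 0 < c <= 1 -> exists y, 0 <= y <= top /\ c <= U y.
Proof.
  intros H1 H2 H3. destruct (escape_strictly F HF top hull Hpeak Hhull c H1 H2 H3) as (y & Hy & HU).
  destruct (reach_low y Hy) as (y' & Hy' & E). exists y'. split; [exact Hy'|]. rewrite E. exact HU.
Qed.

Lemma barrier_in_unit (z : R) : lower_barrier g z -> exists z', lower_barrier g z' /\ -1 < z' <= 0.
Proof.
  intros H. destruct (int_left z) as [k Hk]. exists (z + IZR (- k - 1)).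
  split; [apply lower_shift; assumption|]. rewrite minus_IZR, opp_IZR. lra.
Qed.

(** Let [ts,tr] be the right side of the highest bump and c the first fixed
point of g beyond it.  Then g maps [tr,c] over [0,c], which contains both
intervals, so there are laps of all orders in [0,c], and it remains to see that
U covers [0,c].  It passes below 0 because of the lower barrier.  It reaches c
if g does not pass c from the left.  If g passes c at some x < c, then either
x >= 0 and x, tr, c is a triple for g, or x < 0 and the upper barrier between
c - 1 and x has a translate beyond c, which U passes. *)
Lemma periods_both_barriers (z y ts : R) :
  goes_down F -> goes_up F -> lower_barrier g z -> upper_barrier g y ->
  0 <= ts -> g ts = 0 -> Y ts = top -> forall n, (2 <= n)%nat -> Per F n.
Proof.
  intros Hdown Hup Hz Hy Hts0 Hgts HYts n Hn.
  pose proof (top_range F HF top Hpeak) as Htop.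
  assert (HU0 : U 0 = g 0) by apply (stem_0 F).
  destruct (barrier_in_unit z Hz) as (z0 & Hbar & Hz0).
  destruct (low_below z0 Hdown Hbar Hz0) as (b1 & Hb1 & HUb1).
  assert (Hg0 : z0 <= g 0) by (apply Hbar; lra).
  assert (Hb1' : 0 < b1) by (destruct (Req_dec b1 0) as [E|]; [rewrite E in HUb1; lra|lra]).
  assert (Hbar1 : lower_barrier g (z0 + 1)) by apply (lower_shift F HF z0 1 Hbar).
  assert (Hts1 : ts < z0 + 1).
  { apply Rnot_le_lt. intros H. specialize (Hbar1 ts H). lra. }
  assert (Hgz1 : z0 + 1 <= g (z0 + 1)) by (apply Hbar1; lra).
  destruct (zero_between F HF ts (z0 + 1) Hts1) as [e [He He0]]; [fold g; lra|].
  destruct (climb_right F HF e ts) as (tr & Htr & HYtr & Hbr); [lra|exact He0|fold Y; lra|].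
  fold Y in HYtr, Hbr.
  assert (Hflatg : forall s, ts <= s <= tr -> g s = 0).
  { destruct (const_of_climb F HF ts tr) as [k Hk]; [lra|intros s Hs; apply Hbr; lra|].
    intros s Hs. unfold g. rewrite Hk by lra. rewrite <- (Hk ts) by lra. exact Hgts. }
  destruct (first_ge (fun s => g s - s) tr (z0 + 1) 0) as (c & Hc & Hgc & Hbelow).
  - apply continuity_minus; [apply axisRe_cont, HF|apply derivable_continuous, derivable_id].
  - lra.
  - rewrite Hflatg by lra. lra.
  - lra.
  - assert (Hgtr : g tr = 0) by (apply Hflatg; lra).
    assert (Htrc : tr < c) by (destruct (Req_dec tr c) as [E|]; [rewrite <- E in Hgc; lra|lra]).
    assert (Hlaps : forall j, (1 <= j)%nat -> exists a b, 0 <= a /\ b <= c /\ lap F top j a b).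
    { intros j Hj. induction Hj as [|j Hj (a & b & Ha & Hb & Hlap)].
      - exists ts, tr. split; [lra|]. split; [lra|]. apply lap_one; [lra|right; fold Y; lra].
      - destruct (lap_pull F HF top j a b tr c Hlap) as (a' & b' & H1 & H2 & H3 & _).
        + apply (no_int_unit 0); lra.
        + lra.
        + left. fold g. lra.
        + exists a', b'. split; [lra|]. split; [lra|exact H3]. }
    assert (Hfinish : forall b2, 0 < b2 <= top -> c <= U b2 -> Per F n).
    { intros b2 Hb2 HUb2. destruct (Hlaps (n - 1)%nat) as (a & b & Ha & Hb & Hlap); [lia|].
      replace n with (S (n - 1)) by lia.
      apply (lap_close F HF top (n - 1) a b (Rmin b1 b2) (Rmax b1 b2)).
      - exact Hlap.
      - apply (no_int_unit 0); lra.
      - unfold Rmin, Rmax. destruct (Rle_dec b1 b2); lra.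
      - unfold Rmax. destruct (Rle_dec b1 b2); lra.
      - fold U. unfold covers, Rmin, Rmax. destruct (Rle_dec b1 b2); lra.
      - left. unfold Rmin. destruct (Rle_dec b1 b2); lra. }
    destruct (classic (exists x, x < c /\ c <= g x)) as [(x & Hx & Hgx)|Hno].
    + assert (Hxts : x < ts).
      { apply Rnot_le_lt. intros H. destruct (Rle_dec x tr) as [H'|H'].
        - rewrite Hflatg in Hgx; lra.
        - specialize (Hbelow x). lra. }
      destruct (Rle_dec 0 x) as [Hx0|Hx0].
      * apply (per_of_triple F HF x tr c n); [lia|lra|lra|right; fold g; lra].
      * destruct (int_below (y - (c - 1))) as [q Hq].
        assert (Hq' : upper_barrier g (y + IZR (- q))) by (apply upper_shift; assumption).
        assert (Hyq : y + IZR (- q) < x).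
        { apply Rnot_le_lt. intros H. specialize (Hq' x H). rewrite opp_IZR in *. lra. }
        assert (Hq1 : upper_barrier g (y + IZR (- q + 1))) by (apply upper_shift; assumption).
        rewrite plus_IZR, opp_IZR in *.
        destruct (low_above _ Hup Hq1) as (b2 & Hb2 & HUb2); [lra|].
        assert (g 0 <= y + (- IZR q + 1)) by (apply Hq1; lra).
        apply (Hfinish b2); [|lra].
        destruct (Req_dec b2 0) as [E|]; [rewrite E in HUb2; lra|lra].
    + assert (Hstrict : forall x, x < c -> g x < c).
      { intros x Hx. apply Rnot_le_lt. intros H. apply Hno. exists x. auto. }
      destruct (low_strictly c Hup Hstrict) as (b2 & Hb2 & HUb2); [lra|].
      assert (g 0 < c) by (apply Hstrict; lra).
      apply (Hfinish b2); [|exact HUb2].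
      destruct (Req_dec b2 0) as [E|]; [rewrite E in HUb2; lra|lra].
Qed.

Lemma barrier_closed (m : R) (A : R -> Prop) :
  (forall z, A z -> lower_barrier g z) -> (forall z, A z -> m <= z) ->
  (forall eps, 0 < eps -> exists z, A z /\ z < m + eps) -> lower_barrier g m.
Proof.
  intros HA Hm Happ s Hs.
  assert (Hgt : forall s, m < s -> m <= g s).
  { intros r Hr. destruct (Happ (r - m)) as [z [Hz Hz']]; [lra|].
    specialize (Hm z Hz). assert (z <= g r) by (apply HA; [exact Hz|lra]). lra. }
  destruct (Req_dec s m) as [->|Hne]; [|apply Hgt; lra].
  apply Rnot_lt_le. intros H.
  destruct (sign_stable_lt g m m (axisRe_cont F HF) H) as [d [Hd Hnear]].
  specialize (Hnear (m + d / 2)). specialize (Hgt (m + d / 2)).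
  rewrite Rabs_right in Hnear; lra.
Qed.

(** Let m be the infimum of the lower barriers in (-1,0]; it is a barrier, and U
takes values at most m, and below m if m > -1.

If m > -1, points just left of m are no barriers, so m is fixed by g and does
not climb.  For want of an upper barrier some x in (m,m+1) is sent beyond
m + 1.  If there is a barrier v >= x in (-1,0], then g 0 >= v >= x, so U covers
a part of [m,x] that g sends over [m,m+1]: the case of a repelling side.
Otherwise x is no barrier, some s > x is sent below x, and x, s, m + 1 is a
triple for g.

If m = -1, then 0 is a barrier too and U covers [-1,0]: the case of a repelling
side at -1 if g 0 = 0, of a full turn if g 0 > 0. *)
Lemma periods_lower_only (z : R) :
  goes_down F -> lower_barrier g z -> ~ (exists y, upper_barrier g y) ->
  (forall n, (3 <= n)%nat -> Per F n) /\ (Per F 1 \/ Per F 2).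
Proof.
  intros Hdown Hz Hnoup.
  pose proof (top_range F HF top Hpeak) as Htop.
  assert (HU0 : U 0 = g 0) by apply (stem_0 F).
  destruct (barrier_in_unit z Hz) as (z0 & Hbar & Hz0).
  destruct Hpeak as [Hmax [ts Hts]].
  destruct (continuity_ab_min U 0 top) as [yu [Hmin Hyu]]; [lra|intros; apply stemRe_cont, HF|].
  pose (A := fun x => lower_barrier g x /\ -1 < x <= 0).
  assert (HA0 : A z0) by (split; assumption).
  assert (HUA : forall x, A x -> U yu < x).
  { intros x [Hx Hx']. destruct (low_below x Hdown Hx Hx') as (y & Hy & HU).
    specialize (Hmin y Hy). lra. }
  assert (Htop0 : 0 < top).
  { assert (z0 <= g 0) by (apply Hbar; lra). specialize (HUA z0 HA0).
    destruct (Req_dec yu 0) as [E|]; [rewrite E in HUA; lra|lra]. }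
  destruct (glb_exists A (-1) z0 HA0) as [m [Hm1 Hm2]]; [intros x [_ Hx]; lra|].
  assert (Hbarm : lower_barrier g m) by (apply (barrier_closed m A); [intros x [Hx _]; exact Hx|exact Hm1|exact Hm2]).
  assert (Hm : -1 <= m <= 0).
  { split.
    - apply Rnot_lt_le. intros H. destruct (Hm2 (-1 - m)) as [x [[_ Hx] Hx']]; lra.
    - specialize (Hm1 z0 HA0). lra. }
  assert (HUm : U yu <= m).
  { apply Rnot_lt_le. intros H. destruct (Hm2 (U yu - m)) as [x [Hx Hx']]; [lra|].
    specialize (HUA x Hx). lra. }
  assert (Hfixed : forall x, g x = x -> Per F 1).
  { intros x Hx. apply (per_of_circle_cycle F HF 1 x); [lia|]. split; [|intros j Hj; lia].
    simpl. fold g. rewrite Hx. exists 0%Z. lra. }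
  (* for want of upper barriers, every level is passed from less than 1 below *)
  assert (Hover : forall v, g v <= v -> exists x, v - 1 < x < v /\ v < g x).
  { intros v Hgv. assert (Hs : exists s, s <= v /\ v < g s).
    { apply NNPP. intros Hno. apply Hnoup. exists v. intros s Hs. apply Rnot_lt_le. intros H.
      apply Hno. exists s. auto. }
    destruct Hs as (s & Hs & Hgs). destruct (int_left (s - v)) as [q Hq].
    assert (Hq0 : (q < 0)%Z) by (apply lt_IZR; lra).
    assert (Hq1 : IZR (q + 1) <= 0) by (apply IZR_le; lia). rewrite plus_IZR in Hq1.
    assert (E : g (s + IZR (- q - 1)) = g s + IZR (- q - 1)) by (apply g_shift; assumption).
    exists (s + IZR (- q - 1)). rewrite E. rewrite minus_IZR, opp_IZR in *.
    split; [|lra]. split; [lra|].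
    destruct (Req_dec (s + (- IZR q - 1)) v) as [E'|]; [|lra]. rewrite E' in E. lra. }
  destruct (Req_dec m (-1)) as [Em|Em].
  - subst m.
    assert (Hbar0 : lower_barrier g 0).
    { replace 0 with (-1 + 1) by lra. apply (lower_shift F HF (-1) 1). exact Hbarm. }
    assert (Hg0 : 0 <= g 0) by (apply Hbar0; lra).
    destruct (Req_dec (g 0) 0) as [E|E].
    + assert (Hgm : g (-1) = -1).
      { pose proof (g_shift F HF 0 (-1)) as H. fold g in H. rewrite Rplus_0_l in H. lra. }
      destruct (Hover 0) as (x & Hx & Hgx); [lra|].
      split; [|left; apply (Hfixed (-1)); exact Hgm].
      apply (periods_of_repelling_side F HF top ts yu (-1) x); fold g Y U; try lra; assumption.
    + assert (H2 : forall n, (2 <= n)%nat -> Per F n).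
      { apply (periods_of_full_turn F HF top ts yu); fold g Y U; try lra; assumption. }
      split; [|right; apply H2; lia]. intros n Hn. apply H2. lia.
  - assert (Hm' : -1 < m) by lra.
    assert (HAm : A m) by (split; [exact Hbarm|lra]).
    specialize (HUA m HAm).
    assert (Hnonbar : forall x, -1 < x < m -> exists s, x <= s < m /\ g s < x).
    { intros x Hx. apply NNPP. intros Hno.
      assert (Hx' : A x).
      { split; [|lra]. intros s Hs. apply Rnot_lt_le. intros Hgs. apply Hno. exists s.
        split; [|exact Hgs]. split; [exact Hs|]. apply Rnot_le_lt. intros H.
        specialize (Hbarm s H). lra. }
      specialize (Hm1 x Hx'). lra. }
    assert (Hgm : g m = m).
    { apply Rle_antisym; [|apply Hbarm; lra]. apply Rnot_lt_le. intros H.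
      destruct (sign_stable_gt g m m (axisRe_cont F HF) H) as [d [Hd Hnear]].
      destruct (Hnonbar (Rmax (m - d / 2) ((m - 1) / 2))) as (s & Hs & Hgs).
      - unfold Rmax. destruct (Rle_dec _ _); lra.
      - pose proof (Rmax_l (m - d / 2) ((m - 1) / 2)).
        specialize (Hnear s). rewrite Rabs_left1 in Hnear; lra. }
    assert (HYm : Y m = 0).
    { destruct (axisIm_range F HF m) as [[H|H] _]; [|symmetry; exact H]. exfalso.
      destruct (sign_stable_gt Y m 0 (axisIm_cont F HF) H) as [d [Hd Hnear]].
      destruct (Hnonbar (Rmax (m - d / 2) ((m - 1) / 2))) as (s & Hs & Hgs).
      - unfold Rmax. destruct (Rle_dec _ _); lra.
      - pose proof (Rmax_l (m - d / 2) ((m - 1) / 2)).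
        destruct (const_of_climb F HF s m) as [k Hk]; [lra| |].
        + intros r Hr. apply Hnear. rewrite Rabs_left1; lra.
        + fold g in Hk. rewrite <- (Hk m) in Hk by lra. specialize (Hk s). lra. }
    assert (Hgm1 : g (m + 1) = g m + 1) by apply (g_shift F HF m 1).
    assert (Hbar1 : lower_barrier g (m + 1)) by apply (lower_shift F HF m 1 Hbarm).
    destruct (Hover (m + 1)) as (x & Hx & Hgx); [lra|].
    split; [|left; apply (Hfixed m); exact Hgm].
    destruct (classic (exists v, A v /\ x <= v)) as [(v & [Hv Hv'] & Hxv)|Hno].
    + assert (Hxg0 : x <= g 0) by (assert (v <= g 0) by (apply Hv; lra); lra).
      destruct (ivt_between g m x (m + 1)) as [x' [Hx' Hgx']];
        [apply axisRe_cont, HF|lra|left; lra|].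
      assert (x' <> m) by (intros ->; lra). assert (x' <> x) by (intros ->; lra).
      apply (periods_of_repelling_side F HF top ts yu m x'); fold g Y U; try lra; try assumption.
    + assert (Hs : exists s, x <= s /\ g s < x).
      { apply NNPP. intros Hno'.
        assert (Hxbar : lower_barrier g x).
        { intros s Hs. apply Rnot_lt_le. intros H. apply Hno'. exists s. auto. }
        destruct (Rle_dec x 0) as [Hx0|Hx0].
        - apply Hno. exists x. split; [split; [exact Hxbar|lra]|lra].
        - assert (Hx1 : A (x + IZR (-1))) by (split; [apply lower_shift; assumption|lra]).
          specialize (Hm1 _ Hx1). lra. }
      destruct Hs as (s & Hs & Hgs).
      assert (Hsm : s < m + 1).
      { apply Rnot_le_lt. intros H. specialize (Hbar1 s H). lra. }
      assert (s <> x) by (intros ->; lra).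
      intros n Hn. apply (per_of_triple F HF x s (m + 1) n); [lia|lra|lra|right; fold g; lra].
Qed.

End Assembly.

Lemma periods_of_lower_barrier (F : C -> C) :
  L1 F -> goes_down F -> goes_up F -> (exists z, lower_barrier (axisRe F) z) ->
  (forall n, (3 <= n)%nat -> Per F n) /\ (Per F 1 \/ Per F 2).
Proof.
  intros HF Hdown Hup [z Hz].
  destruct (peak_exists F HF) as (top & Hpeak & Htop).
  destruct (hull_exists F HF top Htop) as (hull & Hhull).
  destruct (classic (exists w, top < w <= hull /\ stemIm F w = 0)) as [(w & Hw & Hhw)|Hno].
  { destruct (barrier_in_unit F HF z Hz) as (z0 & Hbar & Hz0).
    pose proof (periods_of_high_zero F HF top hull Hpeak Hhull z0 w Hdown Hbar Hz0 Hw Hhw) as H.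
    split; [intros n Hn; apply H; lia|left; apply H; lia]. }
  assert (Hflat : forall w, top < w <= hull -> stemIm F w <> 0).
  { intros w Hw E. apply Hno. exists w. auto. }
  destruct (classic (exists y, upper_barrier (axisRe F) y)) as [[y Hy]|Hnoup].
  - destruct (proj2 Hpeak) as [t Ht].
    destruct (Req_dec top 0) as [Htop0|Htop0].
    { (* if nothing climbs, U has to pass the barrier at height 0, where it equals g *)
      destruct (barrier_in_unit F HF z Hz) as (z0 & Hbar & Hz0).
      destruct (low_below F HF top hull Hpeak Hhull Hflat z0 Hdown Hbar Hz0) as (b & Hb & HUb).
      assert (b = 0) as -> by lra. rewrite (proj1 (stem_0 F)) in HUb.
      assert (z0 <= axisRe F 0) by (apply Hbar; lra). lra. }
    destruct (axis_int F HF t) as [k Hk]; [lra|].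
    pose (ts := t + IZR (- k)).
    assert (Hgts : axisRe F ts = 0).
    { unfold ts. rewrite (proj1 (axis_shift F HF _ _)), Hk, opp_IZR. lra. }
    assert (HYts : axisIm F ts = top).
    { unfold ts. rewrite (proj2 (axis_shift F HF _ _)). exact Ht. }
    assert (H2 : forall n, (2 <= n)%nat -> Per F n).
    { intros n Hn. destruct (Rle_dec 0 ts) as [Hts|Hts].
      - apply (periods_both_barriers F HF top hull Hpeak Hhull Hflat z y ts); assumption.
      - apply mirror_per.
        apply (periods_both_barriers (mirror F) (mirror_L1 F HF) top hull (mirror_peak F top Hpeak)
                 (mirror_hull F top hull Hhull)) with (z := - y) (y := - z) (ts := - ts).
        + intros w Hw. rewrite (proj2 (mirror_stem F w)). apply Hflat, Hw.
        + apply mirror_down, Hup.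
        + apply mirror_up, Hdown.
        + apply mirror_lower, Hy.
        + apply mirror_upper, Hz.
        + lra.
        + rewrite (proj1 (mirror_axis F _)), Ropp_involutive, Hgts. lra.
        + rewrite (proj2 (mirror_axis F _)), Ropp_involutive. exact HYts.
        + exact Hn. }
    split; [intros n Hn; apply H2; lia|right; apply H2; lia].
  - apply (periods_lower_only F HF top hull Hpeak Hhull Hflat z Hdown Hz Hnoup).
Qed.

Lemma periods_of_unbounded (F : C -> C) :
  L1 F -> goes_down F -> goes_up F ->
  (forall n, (3 <= n)%nat -> Per F n) /\ (Per F 1 \/ Per F 2).
Proof.
  intros HF Hdown Hup.
  destruct (classic (exists z, lower_barrier (axisRe F) z)) as [Hlow|Hnolow].
  { apply periods_of_lower_barrier; assumption. }
  destruct (classic (exists y, upper_barrier (axisRe F) y)) as [[y Hy]|Hnoup].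
  - destruct (periods_of_lower_barrier (mirror F)) as [H1 H2].
    + apply mirror_L1, HF.
    + apply mirror_down, Hup.
    + apply mirror_up, Hdown.
    + exists (- y). apply mirror_lower, Hy.
    + split; [intros n Hn; apply mirror_per, H1, Hn|].
      destruct H2; [left|right]; apply mirror_per; assumption.
  - destruct (triple_of_no_barrier (axisRe F)) as (a & b & c & H); try assumption;
      [apply axisRe_cont, HF|intros x k; apply axis_shift, HF|].
    assert (Hall : forall n, (1 <= n)%nat -> Per F n).
    { intros n Hn. apply (per_of_triple F HF a b c n); tauto. }
    split; [intros n Hn; apply Hall; lia|left; apply Hall; lia].
Qed.

(** * The rotation hypothesis *)

Definition descend (k : Z) (F : C -> C) (z : C) : C := translate (- k) (F z).

Lemma descend_L1 k F : L1 F -> L1 (descend k F).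
Proof.
  intros HF. assert (HF' := HF). destruct HF' as (H1 & H2 & H3). split; [|split].
  - intros z Hz. apply Sspace_translate, H1, Hz.
  - intros z Hz. apply (filterlim_comp _ _ _ F (translate (- k)) _ (locally (F z))); [apply H2, Hz|].
    apply filterlim_locally. intros eps. exists eps. intros w [B1 B2]. split; [|exact B2].
    unfold translate. simpl. unfold ball in *. simpl in *.
    unfold AbsRing_ball, abs, minus, plus, opp in *. simpl in *.
    replace (fst w + IZR (- k) + - (fst (F z) + IZR (- k))) with (fst w + - fst (F z)) by lra. exact B1.
  - intros z Hz. rewrite (translate_add 1 z), (translate_add 1 (descend k F z)). unfold descend.
    rewrite (F_shift F HF) by exact Hz. rewrite !translate_translate. f_equal. lia.
Qed.

Lemma descend_iter k F n z : L1 F -> Sspace z ->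
  Nat.iter n (descend k F) z = translate (- k * Z.of_nat n) (Nat.iter n F z).
Proof.
  intros HF Hz. induction n as [|n IH]; [rewrite Z.mul_0_r; simpl; now rewrite translate_0|].
  change (Nat.iter (S n) (descend k F) z) with (descend k F (Nat.iter n (descend k F) z)).
  rewrite IH. unfold descend. rewrite (F_shift F HF) by (apply iter_S; assumption).
  rewrite translate_translate. simpl. f_equal. lia.
Qed.

Lemma descend_per k F n : L1 F -> Per (descend k F) n -> Per F n.
Proof.
  intros HF (z & Hz & Hn & Hr & Hmin).
  assert (Hret : forall m, returns_mod1 (descend k F) z m <-> returns_mod1 F z m).
  { intros m. split; intros [q Hq].
    - exists (q + k * Z.of_nat m)%Z. rewrite (descend_iter k F m z HF Hz), translate_add in Hq.
      rewrite translate_add.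
      rewrite <- (translate_0 (Nat.iter m F z)).
      replace 0%Z with (k * Z.of_nat m + - k * Z.of_nat m)%Z by lia.
      rewrite <- translate_translate, Hq, translate_translate. f_equal. lia.
    - exists (- k * Z.of_nat m + q)%Z. rewrite (descend_iter k F m z HF Hz), translate_add.
      rewrite translate_add in Hq. rewrite Hq, translate_translate. reflexivity. }
  exists z. split; [exact Hz|]. split; [exact Hn|]. split; [apply Hret, Hr|].
  intros m Hm Hm'. apply Hmin; [exact Hm|apply Hret, Hm'].
Qed.

Lemma large_INR (c M : R) : 0 < c -> exists N : nat, forall n, (N <= n)%nat -> M < c * INR n.
Proof.
  intros Hc. destruct (INR_unbounded (M / c)) as [N HN]. exists N. intros n Hn.
  apply le_INR in Hn. apply (Rmult_lt_reg_r (/ c)); [apply Rinv_0_lt_compat, Hc|].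
  replace (c * INR n * / c) with (INR n) by (field; lra). unfold Rdiv in HN. lra.
Qed.

Lemma descend_up k F rho : L1 F -> RotR F rho -> IZR k < rho -> goes_up (descend k F).
Proof.
  intros HF ([x y] & Hz & Hlim) Hk. unfold real_axis, Im in Hz. simpl in Hz. subst y.
  exists x. intros M.
  apply is_lim_seq_spec in Hlim.
  destruct (Hlim (mkposreal ((rho - IZR k) / 2) ltac:(lra))) as [N1 HN1].
  destruct (large_INR ((rho - IZR k) / 2) (M - x)) as [N2 HN2]; [lra|].
  exists (N1 + N2 + 1)%nat. intros n Hn.
  specialize (HN1 n ltac:(lia)). specialize (HN2 n ltac:(lia)). simpl in HN1.
  apply Rabs_def2 in HN1. destruct HN1 as [_ HN1].
  assert (Hpos : 0 < INR n) by (apply lt_0_INR; lia).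
  rewrite (descend_iter k F n (x, 0) HF (Sspace_axis x)). simpl. rewrite mult_IZR, opp_IZR, <- INR_IZR_INZ.
  unfold Re in HN1. simpl in HN1.
  assert (Hq : (rho - (rho - IZR k) / 2) * INR n < fst (Nat.iter n F (x, 0)) - x).
  { replace (fst (Nat.iter n F (x, 0)) - x) with ((fst (Nat.iter n F (x, 0)) - x) / INR n * INR n) by (field; lra).
    apply Rmult_lt_compat_r; [exact Hpos|lra]. }
  nra.
Qed.

Lemma descend_down k F rho : L1 F -> RotR F rho -> rho < IZR k -> goes_down (descend k F).
Proof.
  intros HF ([x y] & Hz & Hlim) Hk. unfold real_axis, Im in Hz. simpl in Hz. subst y.
  exists x. intros M.
  apply is_lim_seq_spec in Hlim.
  destruct (Hlim (mkposreal ((IZR k - rho) / 2) ltac:(lra))) as [N1 HN1].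
  destruct (large_INR ((IZR k - rho) / 2) (x - M)) as [N2 HN2]; [lra|].
  exists (N1 + N2 + 1)%nat. intros n Hn.
  specialize (HN1 n ltac:(lia)). specialize (HN2 n ltac:(lia)). simpl in HN1.
  apply Rabs_def2 in HN1. destruct HN1 as [HN1 _].
  assert (Hpos : 0 < INR n) by (apply lt_0_INR; lia).
  rewrite (descend_iter k F n (x, 0) HF (Sspace_axis x)). simpl. rewrite mult_IZR, opp_IZR, <- INR_IZR_INZ.
  unfold Re in HN1. simpl in HN1.
  assert (Hq : fst (Nat.iter n F (x, 0)) - x < (rho + (IZR k - rho) / 2) * INR n).
  { replace (fst (Nat.iter n F (x, 0)) - x) with ((fst (Nat.iter n F (x, 0)) - x) / INR n * INR n) by (field; lra).
    apply Rmult_lt_compat_r; [exact Hpos|lra]. }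
  nra.
Qed.

Lemma periods_of_interior_integer (F : C -> C) (k : Z) :
  L1 F -> Rtopology.interior (RotR F) (IZR k) ->
  (forall n, (3 <= n)%nat -> Per F n) /\ (Per F 1 \/ Per F 2).
Proof.
  intros HF [delta Hd]. pose proof (cond_pos delta) as Hpos.
  assert (Hin : forall t, Rabs (t - IZR k) < delta -> RotR F t) by (intros t Ht; apply Hd, Ht).
  destruct (periods_of_unbounded (descend k F)) as [H1 H2].
  - apply descend_L1, HF.
  - apply (descend_down k F (IZR k - delta / 2) HF); [|lra]. apply Hin. rewrite Rabs_left1; lra.
  - apply (descend_up k F (IZR k + delta / 2) HF); [|lra]. apply Hin. rewrite Rabs_right; lra.
  - split; [intros n Hn; apply (descend_per k F n HF), H1, Hn|].
    destruct H2; [left|right]; apply (descend_per k F _ HF); assumption.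
Qed.

Lemma per_pos F n : Per F n -> (1 <= n)%nat.
Proof. intros (z & _ & Hn & _). exact Hn. Qed.

Lemma three_cases (F : C -> C) (k : Z) : L1 F -> Rtopology.interior (RotR F) (IZR k) ->
  (Per F 1 -> Per F 2 -> same_set (Per F) posnat) /\
  (~ Per F 1 -> same_set (Per F) (posnat_minus 1)) /\
  (~ Per F 2 -> same_set (Per F) (posnat_minus 2)).
Proof.
  intros HF Hint. destruct (periods_of_interior_integer F k HF Hint) as [H3 H12].
  unfold same_set, posnat_minus, posnat. split; [|split].
  - intros H1 H2 n. split; [apply per_pos|]. intros Hn.
    destruct n as [|[|[|n]]]; [lia|exact H1|exact H2|apply H3; lia].
  - intros H1 n. split.
    + intros Hn. split; [apply (per_pos F n Hn)|]. intros ->. contradiction.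
    + intros [Hn Hne]. destruct n as [|[|[|n]]]; [lia|lia|tauto|apply H3; lia].
  - intros H2 n. split.
    + intros Hn. split; [apply (per_pos F n Hn)|]. intros ->. contradiction.
    + intros [Hn Hne]. destruct n as [|[|[|n]]]; [lia|tauto|lia|apply H3; lia].
Qed.

(** * Maps with 0 interior to the rotation interval *)

Section Rotation.
Context (F : C -> C) (HF : L1 F).

Lemma displacement_bound_S : exists K, 0 <= K /\ forall z, Sspace z -> Rabs (fst (F z) - fst z) <= K.
Proof.
  destruct (displacement_bound (axisRe F)) as [K1 [HK1 H1]];
    [apply axisRe_cont, HF|intros x k; apply axis_shift, HF|].
  destruct (continuity_ab_maj (stemRe F) 0 1) as [M [HM _]]; [lra|intros; apply stemRe_cont, HF|].
  destruct (continuity_ab_min (stemRe F) 0 1) as [m [Hm _]]; [lra|intros; apply stemRe_cont, HF|].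
  exists (K1 + Rabs (stemRe F M) + Rabs (stemRe F m)).
  pose proof (Rabs_pos (stemRe F M)). pose proof (Rabs_pos (stemRe F m)).
  split; [lra|]. intros z Hz.
  destruct (Sspace_cases z Hz) as [E|[Hpos [k E]]]; rewrite E.
  - rewrite axis_step. simpl. specialize (H1 (fst z)). apply Rabs_le. lra.
  - rewrite (F_shift F HF) by (apply Sspace_stem; lra). rewrite (stem_step F) by lra. simpl.
    specialize (HM (snd z) ltac:(lra)). specialize (Hm (snd z) ltac:(lra)).
    pose proof (Rle_abs (stemRe F M)). pose proof (Rle_abs (- stemRe F m)) as Hn. rewrite Rabs_Ropp in Hn.
    apply Rabs_le. lra.
Qed.

Context (p q : R) (N : nat) (HN : (1 <= N)%nat) (Hpq : p < q) (Hfree : no_int p q).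
Context (Hcov : covers (fun t => fst (Nat.iter N F (t, 0))) p q (p - 1) (q + 1)).

Lemma one_leg (m : Z) : (-1 <= m <= 1)%Z ->
  exists a b, p <= a /\ a < b /\ b <= q /\
    onto_ends (fun t => fst (Nat.iter N F (t, 0))) a b (p + IZR m) (q + IZR m) /\
    forall t, a <= t <= b -> exists s, p <= s <= q /\ Nat.iter N F (t, 0) = translate m (s, 0) .
Proof.
  intros [Hm1 Hm2]. apply IZR_le in Hm1, Hm2.
  destruct (cover_sub (fun t => fst (Nat.iter N F (t, 0))) p q (p + IZR m) (q + IZR m))
    as (a & b & H1 & H2 & H3 & H4 & H5).
  - apply (cont_axis F HF).
  - lra.
  - lra.
  - destruct Hcov as [H|H]; [left|right]; lra.
  - exists a, b. repeat (split; [assumption|]). intros t Ht.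
    exists (fst (Nat.iter N F (t, 0)) - IZR m). split.
    + pose proof (onto_ends_range (fun t => fst (Nat.iter N F (t, 0))) a b (p + IZR m) (q + IZR m) ltac:(lra) H4 H5 t Ht) as Hr.
      simpl in Hr. lra.
    + rewrite (surjective_pairing (Nat.iter N F (t, 0))) at 1. unfold translate. simpl. f_equal; [lra|].
      apply (zero_on_closure (fun t => snd (Nat.iter N F (t, 0))) a b); [apply (cont_axis F HF)|exact H2| |exact Ht].
      intros s Hs. destruct (Sspace_inv (Nat.iter N F (s, 0))) as [[[H|H] _] Hint].
      * apply (iter_S F HF), Sspace_axis.
      * exfalso. specialize (H5 s Hs). simpl in H5.
        apply (Hfree (fst (Nat.iter N F (s, 0)) - IZR m)); [lra|].
        apply is_int_minus; [apply Hint, H|exists m; reflexivity].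
      * symmetry. exact H.
Qed.

(** Nested intervals: at each leg any of the three translations is available,
whatever has been done before. *)
Lemma itinerary (T : nat -> Z) :
  T 0%nat = 0%Z -> (forall k, (-1 <= T (S k) - T k <= 1)%Z) ->
  exists x, p <= x <= q /\ forall k, p <= fst (Nat.iter (N * k) F (x, 0)) - IZR (T k) <= q.
Proof.
  intros HT0 HT.
  pose (good := fun k (ab : R * R) => fst ab < snd ab /\
     (forall t, fst ab <= t <= snd ab ->
        exists s, p <= s <= q /\ Nat.iter (N * k) F (t, 0) = translate (T k) (s, 0)) /\
     onto_ends (fun t => fst (Nat.iter (N * k) F (t, 0))) (fst ab) (snd ab) (p + IZR (T k)) (q + IZR (T k))).
  assert (Hnext : forall kab : nat * (R * R), exists ab', good (fst kab) (snd kab) ->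
     good (S (fst kab)) ab' /\ fst (snd kab) <= fst ab' /\ snd ab' <= snd (snd kab)).
  { intros [k [a b]]. simpl.
    destruct (classic (good k (a, b))) as [Hg|Hg]; [|exists (a, b); tauto].
    destruct Hg as (Hab & Hloc & Hends). simpl in *.
    destruct (one_leg (T (S k) - T k) (HT k)) as (a1 & b1 & H1 & H2 & H3 & H4 & H5).
    destruct (cover_sub (fun t => fst (Nat.iter (N * k) F (t, 0))) a b (a1 + IZR (T k)) (b1 + IZR (T k)))
      as (a' & b' & H1' & H2' & H3' & H4' & H5').
    - apply (cont_axis F HF).
    - lra.
    - lra.
    - destruct Hends as [[E1 E2]|[E1 E2]]; [left|right]; lra.
    - exists (a', b'). intros _. simpl. split; [|lra].
      assert (Hleg : forall t, a' <= t <= b' -> exists r, a1 <= r <= b1 /\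
                 fst (Nat.iter (N * k) F (t, 0)) = r + IZR (T k) /\
                 Nat.iter (N * S k) F (t, 0) = translate (T k) (Nat.iter N F (r, 0))).
      { intros t Ht. destruct (Hloc t) as (s & Hs & E); [lra|].
        exists s. pose proof (onto_ends_range (fun t => fst (Nat.iter (N * k) F (t, 0))) a' b' (a1 + IZR (T k)) (b1 + IZR (T k)) ltac:(lra) H4' H5' t Ht) as Hr. simpl in Hr.
        rewrite E in Hr. simpl in Hr. split; [lra|]. split; [rewrite E; reflexivity|].
        replace (N * S k)%nat with (N + N * k)%nat by lia. rewrite iter_add, E.
        apply (iter_shift F HF), Sspace_axis. }
      split; [exact H2'|]. simpl. split.
      + intros t Ht. destruct (Hleg t Ht) as (r & Hr & _ & E). destruct (H5 r Hr) as (s & Hs & E').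
        exists s. split; [exact Hs|]. rewrite E, E', translate_translate. f_equal. lia.
      + destruct (Hleg a') as (ra & _ & Ea & Ea'); [lra|].
        destruct (Hleg b') as (rb & _ & Eb & Eb'); [lra|].
        assert (Hra : (ra = a1 /\ rb = b1) \/ (ra = b1 /\ rb = a1))
          by (destruct H4' as [[? ?]|[? ?]]; [left|right]; lra).
        unfold onto_ends. rewrite Ea', Eb'. simpl. rewrite minus_IZR in H4.
        destruct Hra as [[-> ->]|[-> ->]]; destruct H4 as [[E1 E2]|[E1 E2]]; [left|right|right|left]; lra. }
  destruct (functional_choice _ Hnext) as [next Hnext'].
  pose (K := fix K k := match k with 0%nat => (p, q) | S k => next (k, K k) end).
  assert (Hgood : forall k, good k (K k)).
  { induction k as [|k IH].
    - unfold good. rewrite Nat.mul_0_r, HT0. simpl. split; [exact Hpq|]. split; [|left; simpl; lra].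
      intros t Ht. exists t. split; [exact Ht|now rewrite translate_0].
    - apply (Hnext' (k, K k)), IH. }
  assert (Hnest : forall k, fst (K k) <= fst (K (S k)) /\ snd (K (S k)) <= snd (K k)).
  { intros k. apply (Hnext' (k, K k)), Hgood. }
  assert (Hmono : forall j k, (j <= k)%nat -> fst (K j) <= fst (K k) /\ snd (K k) <= snd (K j)).
  { intros j k Hjk. induction Hjk as [|k _ IH]; [lra|]. specialize (Hnest k). lra. }
  assert (Hcross : forall j k, fst (K j) <= snd (K k)).
  { intros j k. destruct (Hmono j (max j k)); [lia|]. destruct (Hmono k (max j k)); [lia|].
    destruct (Hgood (max j k)) as [H' _]. lra. }
  destruct (completeness (fun x => exists k, x = fst (K k))) as [x [Hx1 Hx2]].
  - exists (snd (K 0%nat)). intros x [k ->]. apply Hcross.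
  - exists (fst (K 0%nat)), 0%nat. reflexivity.
  - assert (Hin : forall k, fst (K k) <= x <= snd (K k)).
    { intros k. split; [apply Hx1; exists k; reflexivity|]. apply Hx2. intros y [j ->]. apply Hcross. }
    exists x. split; [apply (Hin 0%nat)|]. intros k.
    destruct (Hgood k) as (_ & Hloc & _). destruct (Hloc x (Hin k)) as (s & Hs & ->). simpl. lra.
Qed.

Lemma displacement_iter (K : R) (n : nat) (z : C) :
  (forall z, Sspace z -> Rabs (fst (F z) - fst z) <= K) -> Sspace z ->
  Rabs (fst (Nat.iter n F z) - fst z) <= INR n * K.
Proof.
  intros HK Hz. induction n as [|n IH].
  - simpl. rewrite Rminus_diag, Rabs_R0. lra.
  - rewrite S_INR. simpl.
    replace (fst (F (Nat.iter n F z)) - fst z)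
      with ((fst (F (Nat.iter n F z)) - fst (Nat.iter n F z)) + (fst (Nat.iter n F z) - fst z)) by lra.
    eapply Rle_trans; [apply Rabs_triang|].
    specialize (HK (Nat.iter n F z) (iter_S F HF n z Hz)). lra.
Qed.

Lemma rotation_of_bounded (x rho K : R) :
  (forall n, Rabs (fst (Nat.iter n F (x, 0)) - x - INR n * rho) <= K) -> RotR F rho.
Proof.
  intros HK. exists (x, 0). split; [reflexivity|].
  apply is_lim_seq_spec. intros eps. destruct (large_INR eps K (cond_pos eps)) as [M HM].
  exists (M + 1)%nat. intros n Hn. specialize (HM n ltac:(lia)). specialize (HK n).
  assert (Hpos : 0 < INR n) by (apply lt_0_INR; lia).
  unfold Re. simpl.
  replace ((fst (Nat.iter n F (x, 0)) - x) / INR n - rho)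
    with ((fst (Nat.iter n F (x, 0)) - x - INR n * rho) / INR n) by (field; lra).
  unfold Rdiv. rewrite Rabs_mult, (Rabs_right (/ INR n)) by (left; apply Rinv_0_lt_compat, Hpos).
  apply (Rmult_lt_reg_r (INR n)); [exact Hpos|].
  rewrite Rmult_assoc, Rinv_l by lra. lra.
Qed.

(** The rotation number rho is realised by the itinerary floor (k theta), where
theta = rho N.  Its increments are -1, 0 or 1 when rho is less than 1 / N in
absolute value. *)
Lemma interior_of_legs : Rtopology.interior (RotR F) 0.
Proof.
  destruct displacement_bound_S as [K [HK0 HK]].
  assert (HNR : 1 <= INR N) by (change 1 with (INR 1); apply le_INR, HN).
  assert (Hdelta : 0 < / INR N) by (apply Rinv_0_lt_compat; lra).
  exists (mkposreal _ Hdelta). intros rho Hrho. unfold disc in Hrho. simpl in Hrho.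
  rewrite Rminus_0_r in Hrho. pose (theta := rho * INR N).
  assert (Htheta : -1 < theta < 1).
  { apply Rabs_def2 in Hrho. unfold theta.
    assert (E : / INR N * INR N = 1) by (field; lra). nra. }
  assert (Hfloor : forall t, exists k : Z, IZR k <= t < IZR k + 1) by apply int_below.
  destruct (functional_choice _ Hfloor) as [fl Hfl].
  destruct (itinerary (fun k => fl (INR k * theta))) as (x & Hx & Hit).
  - specialize (Hfl (INR 0 * theta)). simpl INR in *. rewrite Rmult_0_l in *.
    assert (fl 0%R <= 0)%Z by (apply le_IZR; lra). assert (-1 < fl 0%R)%Z by (apply lt_IZR; lra). lia.
  - intros k. pose proof (Hfl (INR k * theta)) as H1. pose proof (Hfl (INR (S k) * theta)) as H2.
    rewrite S_INR in *.
    assert (fl ((INR k + 1) * theta)%R - fl (INR k * theta)%R < 2)%Z by (apply lt_IZR; rewrite minus_IZR; lra).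
    assert (-2 < fl ((INR k + 1) * theta)%R - fl (INR k * theta)%R)%Z by (apply lt_IZR; rewrite minus_IZR; lra).
    lia.
  - apply (rotation_of_bounded x rho (Rabs p + Rabs q + Rabs x + 1 + INR N * K + INR N * Rabs rho)).
    intros n. pose (k := (n / N)%nat). pose (r := (n mod N)%nat).
    assert (En : n = (r + N * k)%nat) by (unfold r, k; rewrite (Nat.div_mod_eq n N) at 1; lia).
    assert (Hr : (r < N)%nat) by (apply Nat.mod_upper_bound; lia).
    assert (HrR : 0 <= INR r <= INR N) by (split; [apply pos_INR|apply le_INR; lia]).
    specialize (Hit k). pose proof (Hfl (INR k * theta)) as Hk.
    pose proof (displacement_iter K r (Nat.iter (N * k) F (x, 0)) HK
                  (iter_S F HF _ _ (Sspace_axis x))) as Hd.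
    rewrite <- iter_add, <- En in Hd.
    assert (Hd' : Rabs (fst (Nat.iter n F (x, 0)) - fst (Nat.iter (N * k) F (x, 0))) <= INR N * K) by nra.
    assert (EnR : INR n * rho = INR k * theta + INR r * rho).
    { rewrite En, plus_INR, mult_INR. unfold theta. ring. }
    assert (Hrr : Rabs (INR r * rho) <= INR N * Rabs rho).
    { rewrite Rabs_mult, (Rabs_right (INR r)) by lra. pose proof (Rabs_pos rho). nra. }
    rewrite EnR. apply Rabs_le_between in Hd', Hrr.
    pose proof (Rle_abs p). pose proof (Rle_abs q). pose proof (Rle_abs x).
    pose proof (Rle_abs (- p)) as Hp'. pose proof (Rle_abs (- q)) as Hq'. pose proof (Rle_abs (- x)) as Hx'.
    rewrite Rabs_Ropp in Hp', Hq', Hx'.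
    pose proof (Rabs_pos p). pose proof (Rabs_pos q). pose proof (Rabs_pos x).
    apply Rabs_le. lra.
Qed.

End Rotation.

(** * Piecewise affine examples *)

Lemma continuity_Rmin (f1 f2 : R -> R) :
  continuity f1 -> continuity f2 -> continuity (fun x => Rmin (f1 x) (f2 x)).
Proof.
  intros H1 H2 x.
  apply (continuity_pt_ext (fun t => - Rmax (- f1 t) (- f2 t))).
  - intros t. unfold Rmax, Rmin. repeat destruct (Rle_dec _ _); lra.
  - apply continuity_pt_opp. apply (continuity_Rmax (fun t => - f1 t) (fun t => - f2 t));
      apply continuity_opp; assumption.
Qed.

Definition frac (x : R) : R := x - IZR (Int_part x).

Lemma frac_range x : 0 <= frac x < 1.
Proof. unfold frac. destruct (base_Int_part x). lra. Qed.

Lemma Int_part_unique (k : Z) (x : R) : IZR k <= x < IZR k + 1 -> Int_part x = k.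
Proof.
  intros Hx. destruct (base_Int_part x) as [H1 H2].
  assert (Int_part x < k + 1)%Z by (apply lt_IZR; rewrite plus_IZR; lra).
  assert (k - 1 < Int_part x)%Z by (apply lt_IZR; rewrite minus_IZR; lra). lia.
Qed.

Lemma continuity_id : continuity (fun x => x).
Proof. apply derivable_continuous, derivable_id. Qed.
Lemma continuity_cst (c : R) : continuity (fun _ => c).
Proof. apply continuity_const. intros x y. reflexivity. Qed.

Lemma periodic_cont (P : R -> R) : continuity P -> P 0 = P 1 -> continuity (fun x => P (frac x)).
Proof.
  intros HP H01 x0. destruct (int_below (x0 + 1 / 2)) as [k Hk].
  (* one formula for both sides of the integer k *)
  apply (continuity_pt_ext_loc
    (fun x => P (Rmin (x - IZR k + 1) 1) + P (Rmax (x - IZR k) 0) - P 0)).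
  - exists (mkposreal (1 / 2) ltac:(lra)). intros x Hx.
    assert (Hx' : Rabs (x - x0) < 1 / 2) by exact Hx. apply Rabs_def2 in Hx'.
    destruct (Rlt_dec x (IZR k)) as [Hlt|Hge].
    + rewrite Rmin_left, Rmax_right by lra. unfold frac. rewrite (Int_part_unique (k - 1) x).
      * rewrite minus_IZR. replace (x - (IZR k - 1)) with (x - IZR k + 1) by lra. lra.
      * rewrite minus_IZR. lra.
    + rewrite Rmin_right, Rmax_left by lra. unfold frac. rewrite (Int_part_unique k x) by lra. lra.
  - assert (Hs : continuity (fun x => x - IZR k))
      by (apply continuity_minus; [apply continuity_id|apply continuity_cst]).
    apply continuity_pt_minus; [apply continuity_pt_plus|apply continuity_cst].
    + apply (continuity_comp (fun x => Rmin (x - IZR k + 1) 1) P); [|exact HP].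
      apply continuity_Rmin; [apply continuity_plus; [exact Hs|]|]; apply continuity_cst.
    + apply (continuity_comp (fun x => Rmax (x - IZR k) 0) P); [|exact HP].
      apply continuity_Rmax; [exact Hs|apply continuity_cst].
Qed.

(** G and B describe the map on the unit interval of the axis.  The branch is
sent to the axis, from G 0, with constant speed c. *)
Definition comb (G B : R -> R) (c : R) (z : C) : C :=
  (IZR (Int_part (fst z)) + G (frac (fst z)) + c * snd z, B (frac (fst z))).

Arguments comb : simpl never.

Definition comb_data (G B : R -> R) : Prop :=
  continuity G /\ continuity B /\ G 1 = G 0 + 1 /\ B 0 = 0 /\ B 1 = 0 /\
  forall s, 0 <= s <= 1 -> 0 <= B s <= 1 /\ (B s = 0 \/ is_int (G s)).

Lemma frac_add_int (x : R) (k : Z) : Int_part (x + IZR k) = (Int_part x + k)%Z /\ frac (x + IZR k) = frac x.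
Proof.
  destruct (base_Int_part x) as [H1 H2].
  assert (E : Int_part (x + IZR k) = (Int_part x + k)%Z)
    by (apply Int_part_unique; rewrite plus_IZR; lra).
  split; [exact E|]. unfold frac. rewrite E, plus_IZR. lra.
Qed.

Lemma comb_L1 (G B : R -> R) (c : R) : comb_data G B -> L1 (comb G B c).
Proof.
  intros (HG & HB & HG1 & HB0 & HB1 & Hval). split; [|split].
  - intros z Hz. destruct (Sspace_cases z Hz) as [E|[Hpos [k E]]].
    + rewrite E. unfold comb. simpl. destruct (Hval (frac (fst z))) as [H1 [H2|[m H2]]].
      * pose proof (frac_range (fst z)). lra.
      * left. exact H2.
      * right. split; [|exact H1]. unfold Re. simpl. exists (Int_part (fst z) + m)%Z.
        rewrite H2, plus_IZR. lra.
    + rewrite E. unfold comb. simpl. left. unfold real_axis, Im. simpl.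
      unfold frac. rewrite Rplus_0_l, (Int_part_unique k) by lra. rewrite Rminus_diag. exact HB0.
  - intros z _.
    assert (C1 : continuity (fun x => IZR (Int_part x) + G (frac x))).
    { assert (H : continuity (fun x => x + (fun s => G s - s) (frac x))).
      { apply continuity_plus; [apply continuity_id|]. apply (periodic_cont (fun s => G s - s)); [|lra].
        apply continuity_minus; [exact HG|apply continuity_id]. }
      intros x. specialize (H x). revert H. apply continuity_pt_ext. intros t. unfold frac. lra. }
    assert (C2 : continuity (fun x => B (frac x))) by (apply periodic_cont; [exact HB|lra]).
    assert (H1 : filterlim (fun z : C => IZR (Int_part (fst z)) + G (frac (fst z)) + c * snd z) (locally z)
              (locally (IZR (Int_part (fst z)) + G (frac (fst z)) + c * snd z))).
    { apply (continuous_plus (fun z : C => IZR (Int_part (fst z)) + G (frac (fst z))) (fun z : C => c * snd z)).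
      - apply (continuous_comp (fun z : C => fst z) (fun x => IZR (Int_part x) + G (frac x))).
        + apply continuous_fst.
        + apply continuity_pt_filterlim, C1.
      - apply (continuous_scal_r c (fun z : C => snd z)). apply continuous_snd. }
    assert (H2 : filterlim (fun z : C => B (frac (fst z))) (locally z) (locally (B (frac (fst z))))).
    { apply (continuous_comp (fun z : C => fst z) (fun x => B (frac x))).
      - apply continuous_fst.
      - apply continuity_pt_filterlim, C2. }
    apply filterlim_locally. intros eps.
    assert (Hb1 := proj1 (filterlim_locally _ _) H1 eps).
    assert (Hb2 := proj1 (filterlim_locally _ _) H2 eps).
    change (locally z (fun w => Sspace w -> ball (comb G B c z) eps (comb G B c w))).
    generalize (filter_and _ _ Hb1 Hb2). apply filter_imp. intros w [W1 W2] _. split; assumption.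
  - intros z _. rewrite (translate_add 1 z), (translate_add 1 (comb G B c z)). unfold comb, translate. simpl.
    destruct (frac_add_int (fst z) 1) as [E1 E2]. simpl in E1, E2. rewrite E1, E2, plus_IZR. f_equal. lra.
Qed.

Lemma comb_axis (G B : R -> R) (c s : R) (k : Z) : comb_data G B -> 0 <= s <= 1 ->
  comb G B c (s + IZR k, 0) = (G s + IZR k, B s).
Proof.
  intros (_ & _ & HG1 & HB0 & HB1 & _) Hs.
  unfold comb. simpl. destruct (Req_dec s 1) as [->|Hne].
  - unfold frac. rewrite (Int_part_unique (k + 1)) by (rewrite plus_IZR; lra). rewrite plus_IZR.
    replace (1 + IZR k - (IZR k + 1)) with 0 by lra. rewrite HB0, HB1. f_equal. lra.
  - unfold frac. rewrite (Int_part_unique k) by lra.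
    replace (s + IZR k - IZR k) with s by lra. f_equal. lra.
Qed.

Lemma comb_stem (G B : R -> R) (c y : R) (k : Z) : comb_data G B ->
  comb G B c (IZR k, y) = (G 0 + c * y + IZR k, 0).
Proof.
  intros (_ & _ & HG1 & HB0 & HB1 & _). unfold comb, frac. simpl.
  rewrite (Int_part_unique k) by lra. rewrite Rminus_diag, HB0. f_equal. lra.
Qed.

Definition ramp (a b s : R) : R := Rmax 0 (Rmin (s - a) (b - a)).

Lemma ramp_cont a b : continuity (ramp a b).
Proof.
  apply continuity_Rmax; [apply continuity_cst|]. apply continuity_Rmin; [|apply continuity_cst].
  apply continuity_minus; [apply continuity_id|apply continuity_cst].
Qed.

Lemma ramp_before a b s : a <= b -> s <= a -> ramp a b s = 0.
Proof. intros. unfold ramp, Rmax, Rmin. repeat destruct (Rle_dec _ _); lra. Qed.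
Lemma ramp_inside a b s : a <= s <= b -> ramp a b s = s - a.
Proof. intros. unfold ramp, Rmax, Rmin. repeat destruct (Rle_dec _ _); lra. Qed.
Lemma ramp_after a b s : a <= b -> b <= s -> ramp a b s = b - a.
Proof. intros. unfold ramp, Rmax, Rmin. repeat destruct (Rle_dec _ _); lra. Qed.

Ltac ramps := repeat first
  [ rewrite ramp_before by lra | rewrite ramp_inside by lra | rewrite ramp_after by lra ].

(** Computes iterates without unfolding the map. *)
Ltac unroll := cbv beta iota delta [Nat.iter nat_rect].

Ltac cont_ramps := unfold Rminus, Rdiv;
  repeat first [ apply continuity_plus | apply continuity_opp | apply continuity_mult
               | apply ramp_cont | apply continuity_cst ].

Definition G0 (s : R) : R := -4 * ramp 0 (1/4) s + 6 * ramp (1/4) (3/4) s + -4 * ramp (3/4) 1 s.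
Definition B0 (s : R) : R := 0.
Definition F0 : C -> C := comb G0 B0 0.

Lemma F0_data : comb_data G0 B0.
Proof.
  unfold comb_data, G0, B0. split; [cont_ramps|]. split; [apply continuity_cst|].
  split; [ramps; lra|]. split; [reflexivity|]. split; [reflexivity|]. intros s Hs. split; [lra|]. left; reflexivity.
Qed.

Lemma F0_interior : Rtopology.interior (RotR F0) 0.
Proof.
  assert (E1 : F0 (1/4, 0) = (-1, 0)).
  { replace (1/4) with (1/4 + 0) by lra. unfold F0. rewrite (comb_axis G0 B0 0 (1/4) 0 F0_data) by lra.
    unfold G0, B0. ramps. f_equal. lra. }
  assert (E2 : F0 (3/4, 0) = (2, 0)).
  { replace (3/4) with (3/4 + 0) by lra. unfold F0. rewrite (comb_axis G0 B0 0 (3/4) 0 F0_data) by lra.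
    unfold G0, B0. ramps. f_equal. lra. }
  apply (interior_of_legs F0 (comb_L1 _ _ _ F0_data) (1/4) (3/4) 1).
  - lia.
  - lra.
  - apply (no_int_unit 0); lra.
  - left. unroll. rewrite E1, E2. simpl. lra.
Qed.

Lemma F0_period_one : Per F0 1.
Proof.
  assert (E : F0 (0, 0) = (0, 0)).
  { replace (0, 0) with (0 + IZR 0, 0) at 1 by (f_equal; lra). unfold F0.
    rewrite (comb_axis G0 B0 0 0 0 F0_data) by lra. unfold G0, B0. ramps. f_equal; lra. }
  apply (per_intro F0 (0, 0) 1); [apply Sspace_axis|lia| | |intros j Hj; lia].
  - unroll. rewrite E. reflexivity.
  - unroll. rewrite E. simpl. exists 0%Z. lra.
Qed.

Lemma F0_period_two : Per F0 2.
Proof.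
  assert (E1 : F0 (9/14, 0) = (5/14 + IZR 1, 0)).
  { replace (9/14) with (9/14 + IZR 0) by lra. unfold F0. rewrite (comb_axis G0 B0 0 (9/14) 0 F0_data) by lra.
    unfold G0, B0. ramps. f_equal. lra. }
  assert (E2 : F0 (5/14 + IZR 1, 0) = (9/14, 0)).
  { unfold F0. rewrite (comb_axis G0 B0 0 (5/14) 1 F0_data) by lra.
    unfold G0, B0. ramps. f_equal. lra. }
  apply (per_intro F0 (9/14, 0) 2); [apply Sspace_axis|lia| | |].
  - unroll. rewrite E1, E2. reflexivity.
  - unroll. rewrite E1, E2. simpl. exists 0%Z. lra.
  - intros j Hj _. replace j with 1%nat by lia. unroll. rewrite E1. simpl.
    apply (not_int_between 0). lra.
Qed.

(** G1 s - s lies strictly between 0 and 1 and the branch is sent to the axis, so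
nothing is fixed mod 1.  Orbits go down through the bump on [1/3,2/3] only: in
two steps its peak 1/2 reaches -1, while 1/3 reaches 3/2. *)
Definition G1 (s : R) : R := 1/2 + (3/2) * ramp 0 (1/3) s + (3/2) * ramp (2/3) 1 s.
Definition B1 (s : R) : R := 6 * ramp (1/3) (1/2) s + -6 * ramp (1/2) (2/3) s.
Definition F1 : C -> C := comb G1 B1 (- (5/2)).

Lemma F1_data : comb_data G1 B1.
Proof.
  unfold comb_data, G1, B1. split; [cont_ramps|]. split; [cont_ramps|].
  split; [ramps; lra|]. split; [ramps; lra|]. split; [ramps; lra|]. intros s Hs.
  destruct (Rle_dec s (1/3)); [ramps; split; [lra|left; lra]|].
  destruct (Rle_dec s (1/2)); [ramps; split; [lra|right; exists 1%Z; lra]|].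
  destruct (Rle_dec s (2/3)); [ramps; split; [lra|right; exists 1%Z; lra]|].
  ramps; split; [lra|left; lra].
Qed.

Lemma F1_interior : Rtopology.interior (RotR F1) 0.
Proof.
  assert (E1 : F1 (1/3, 0) = (IZR 1, 0)).
  { replace (1/3) with (1/3 + IZR 0) by lra. unfold F1. rewrite (comb_axis G1 B1 _ (1/3) 0 F1_data) by lra.
    unfold G1, B1. ramps. f_equal; lra. }
  assert (E2 : F1 (1/2, 0) = (IZR 1, 1)).
  { replace (1/2) with (1/2 + IZR 0) by lra. unfold F1. rewrite (comb_axis G1 B1 _ (1/2) 0 F1_data) by lra.
    unfold G1, B1. ramps. f_equal; lra. }
  assert (E3 : forall y, F1 (IZR 1, y) = (3/2 - 5/2 * y, 0)).
  { intros y. unfold F1. rewrite (comb_stem G1 B1 _ y 1 F1_data). unfold G1. ramps. f_equal. lra. }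
  apply (interior_of_legs F1 (comb_L1 _ _ _ F1_data) (1/3) (1/2) 2).
  - lia.
  - lra.
  - apply (no_int_unit 0); lra.
  - right. unroll. rewrite E1, E2, !E3. simpl. lra.
Qed.

Lemma F1_no_period_one : ~ Per F1 1.
Proof.
  intros (z & Hz & _ & [k Hk] & _). rewrite translate_add in Hk. simpl in Hk.
  destruct (Sspace_cases z Hz) as [E|[Hpos [m E]]].
  - pose proof (frac_range (fst z)) as Hs. set (s := frac (fst z)) in *.
    assert (Ez : z = (s + IZR (Int_part (fst z)), 0)) by (rewrite E; unfold s, frac; simpl; f_equal; lra).
    rewrite Ez in Hk. unfold F1 in Hk. rewrite (comb_axis G1 B1 _ s _ F1_data) in Hk by lra.
    unfold translate in Hk. simpl in Hk. injection Hk as Hk _.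
    apply (not_int_between 0 (G1 s - s)); [|exists k; lra].
    unfold G1.
    destruct (Rle_dec s (1/3)); [ramps; lra|]. destruct (Rle_dec s (2/3)); ramps; lra.
  - assert (Hsnd : snd (F1 z) = 0).
    { rewrite E. change (translate m (0, snd z)) with (0 + IZR m, snd z). rewrite Rplus_0_l.
      unfold F1. rewrite (comb_stem G1 B1 _ _ m F1_data). reflexivity. }
    rewrite Hk in Hsnd. simpl in Hsnd. lra.
Qed.

(** The bump is on [0,1/2].  Its branch is sent to [-7/16,0], which is disjoint
mod 1 from the interior of the bump, and this interval expands to the left from
the fixed point -1/4 until it reaches the next bump: orbits go down in this
way.  They go up through [3/4,7/8], which the slope 81/10 stretches slightly
beyond 7/4, the next translate of the fixed point.  An orbit of period 2 using
this passage would require lambda^2 - 8 lambda - 1 >= 0 for the slope lambda,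
which fails for 81/10, but three steps are enough to pass 7/4 + 1/8. *)
Definition G2 (s : R) : R := 3 * ramp (1/2) (3/4) s + (81/10) * ramp (3/4) (7/8) s + - (61/10) * ramp (7/8) 1 s.
Definition B2 (s : R) : R := 4 * ramp 0 (1/4) s + -4 * ramp (1/4) (1/2) s.
Definition F2 : C -> C := comb G2 B2 (- (7/16)).

Lemma G2_low s : 0 <= s <= 1/2 -> G2 s = 0. Proof. intros. unfold G2. ramps. lra. Qed.
Lemma G2_mid s : 1/2 <= s <= 3/4 -> G2 s = 3 * (s - 1/2). Proof. intros. unfold G2. ramps. lra. Qed.
Lemma G2_steep s : 3/4 <= s <= 7/8 -> G2 s = 3/4 + 81/10 * (s - 3/4). Proof. intros. unfold G2. ramps. lra. Qed.
Lemma G2_back s : 7/8 <= s <= 1 -> G2 s = 1 + 61/10 * (1 - s). Proof. intros. unfold G2. ramps. lra. Qed.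
Lemma B2_bump s : 0 <= s <= 1/2 -> 0 <= B2 s <= 1.
Proof. intros. unfold B2. destruct (Rle_dec s (1/4)); ramps; lra. Qed.
Lemma B2_flat s : 1/2 <= s <= 1 -> B2 s = 0. Proof. intros. unfold B2. ramps. lra. Qed.

Lemma F2_data : comb_data G2 B2.
Proof.
  unfold comb_data. split; [unfold G2; cont_ramps|]. split; [unfold B2; cont_ramps|].
  split; [unfold G2; ramps; lra|]. split; [unfold B2; ramps; lra|]. split; [unfold B2; ramps; lra|].
  intros s Hs. destruct (Rle_dec s (1/2)).
  - split; [apply B2_bump; lra|right; exists 0%Z; apply G2_low; lra].
  - split; [rewrite B2_flat; lra|left; apply B2_flat; lra].
Qed.

Lemma F2_axis s k : 0 <= s <= 1 -> F2 (s + IZR k, 0) = (G2 s + IZR k, B2 s).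
Proof. apply comb_axis, F2_data. Qed.
Lemma F2_stem y k : F2 (IZR k, y) = (- (7/16) * y + IZR k, 0).
Proof. unfold F2. rewrite (comb_stem G2 B2 _ y k F2_data), G2_low by lra. f_equal. lra. Qed.

Lemma F2_axis_eq x s k : x = s + IZR k -> 0 <= s <= 1 -> F2 (x, 0) = (G2 s + IZR k, B2 s).
Proof. intros -> Hs. apply F2_axis, Hs. Qed.

Lemma F2_interior : Rtopology.interior (RotR F2) 0.
Proof.
  assert (E1 : F2 (1/4, 0) = (IZR 0, 1)).
  { rewrite (F2_axis_eq (1/4) (1/4) 0) by lra. rewrite G2_low by lra. unfold B2. ramps. f_equal; lra. }
  assert (E2 : F2 (IZR 0, 1) = (- (7/16), 0)) by (rewrite F2_stem; f_equal; lra).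
  assert (E3 : F2 (- (7/16), 0) = (- (13/16), 0)).
  { rewrite (F2_axis_eq (- (7/16)) (9/16) (-1)) by lra. rewrite G2_mid, B2_flat by lra. f_equal. lra. }
  assert (E4 : F2 (7/8, 0) = (141/80, 0)).
  { rewrite (F2_axis_eq (7/8) (7/8) 0) by lra. rewrite G2_back, B2_flat by lra. f_equal. lra. }
  assert (E5 : F2 (141/80, 0) = (1481/800, 0)).
  { rewrite (F2_axis_eq (141/80) (61/80) 1) by lra. rewrite G2_steep, B2_flat by lra. f_equal. lra. }
  assert (E6 : fst (F2 (1481/800, 0)) = 7/4 + 81/10 * (81/800)).
  { rewrite (F2_axis_eq (1481/800) (681/800) 1) by lra. rewrite G2_steep by lra. simpl. lra. }
  apply (interior_of_legs F2 (comb_L1 _ _ _ F2_data) (1/4) (7/8) 3).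
  - lia.
  - lra.
  - apply (no_int_unit 0); lra.
  - left. unroll. rewrite E1, E2, E3, E4, E5, E6. simpl. lra.
Qed.

Lemma int_eq (v : R) (k : Z) : is_int v -> IZR k - 1 < v < IZR k + 1 -> v = IZR k.
Proof.
  intros [m ->] [H1 H2]. assert (m < k + 1)%Z by (apply lt_IZR; rewrite plus_IZR; lra).
  assert (k - 1 < m)%Z by (apply lt_IZR; rewrite minus_IZR; lra). f_equal. lia.
Qed.

Lemma F2_double_return (s : R) : 0 <= s < 1 ->
  snd (F2 (F2 (s, 0))) = 0 -> is_int (fst (F2 (F2 (s, 0))) - s) ->
  snd (F2 (s, 0)) = 0 /\ is_int (fst (F2 (s, 0)) - s).
Proof.
  intros Hs Him Hret.
  assert (Es : F2 (s, 0) = (G2 s, B2 s)) by (rewrite (F2_axis_eq s s 0) by lra; f_equal; lra).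
  rewrite Es in *.
  destruct (Rle_dec s (1/2)) as [H1|H1].
  { (* a climb and a fall to [-7/16,0]: only s = 0 can come back *)
    rewrite G2_low in * by lra. pose proof (B2_bump s ltac:(lra)) as Hb.
    change 0 with (IZR 0) in Hret at 1. rewrite F2_stem in Hret. simpl in Hret.
    assert (Hz : - (7/16) * B2 s + 0 - s = IZR 0) by (apply int_eq; [exact Hret|simpl; lra]).
    simpl in Hz. assert (s = 0) as -> by lra. simpl. split; [lra|exists 0%Z; lra]. }
  rewrite B2_flat in * by lra.
  destruct (Rle_dec s (3/4)) as [H2|H2].
  { rewrite G2_mid in * by lra.
    destruct (Rle_dec (3 * (s - 1/2)) (1/2)) as [H3|H3].
    - rewrite (F2_axis_eq _ (3 * (s - 1/2)) 0) in Hret by lra. rewrite G2_low in Hret by lra. simpl in Hret.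
      exfalso. apply (not_int_between (-1) (0 + 0 - s)); [lra|exact Hret].
    - rewrite (F2_axis_eq _ (3 * (s - 1/2)) 0) in Hret by lra. rewrite G2_mid in Hret by lra. simpl in Hret.
      apply (int_eq _ 0) in Hret; [|simpl; lra]. simpl in *. split; [lra|exists 0%Z; lra]. }
  destruct (Rle_dec s (7/8)) as [H3|H3].
  { rewrite G2_steep in * by lra. set (X := 3/4 + 81/10 * (s - 3/4)) in *.
    destruct (Rle_dec X (7/8)) as [H4|H4].
    { rewrite (F2_axis_eq X X 0) in Hret by (unfold X in *; lra).
      rewrite G2_steep in Hret by (unfold X in *; lra). simpl in Hret.
      apply (int_eq _ 0) in Hret; [|unfold X in *; simpl; lra]. simpl in *. unfold X in *.
      split; [lra|exists 0%Z; lra]. }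
    exfalso.
    destruct (Rle_dec X 1) as [H5|H5].
    { rewrite (F2_axis_eq X X 0) in Hret by (unfold X in *; lra).
      rewrite G2_back in Hret by (unfold X in *; lra). simpl in Hret.
      apply (int_eq _ 1) in Hret; [|unfold X in *; simpl; lra]. simpl in Hret. unfold X in *. lra. }
    destruct (Rle_dec X (3/2)) as [H6|H6].
    { rewrite (F2_axis_eq X (X - 1) 1) in Hret by (unfold X in *; lra).
      rewrite G2_low in Hret by (unfold X in *; lra). simpl in Hret.
      apply (not_int_between 0 (0 + 1 - s)); [lra|exact Hret]. }
    destruct (Rle_dec X (7/4)) as [H7|H7].
    { rewrite (F2_axis_eq X (X - 1) 1) in Hret by (unfold X in *; lra).
      rewrite G2_mid in Hret by (unfold X in *; lra). simpl in Hret.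
      apply (int_eq _ 1) in Hret; [|unfold X in *; simpl; lra]. simpl in Hret. unfold X in *. lra. }
    rewrite (F2_axis_eq X (X - 1) 1) in Hret by (unfold X in *; lra).
    rewrite G2_steep in Hret by (unfold X in *; lra). simpl in Hret.
    apply (int_eq _ 1) in Hret; [|unfold X in *; simpl; lra]. simpl in Hret. unfold X in *. lra. }
  exfalso. rewrite G2_back in * by lra. set (X := 1 + 61/10 * (1 - s)) in *.
  destruct (Rle_dec X (3/2)) as [H6|H6].
  { rewrite (F2_axis_eq X (X - 1) 1) in Hret by (unfold X in *; lra).
    rewrite G2_low in Hret by (unfold X in *; lra). simpl in Hret.
    apply (not_int_between 0 (0 + 1 - s)); [lra|exact Hret]. }
  destruct (Rle_dec X (7/4)) as [H7|H7].
  { rewrite (F2_axis_eq X (X - 1) 1) in Hret by (unfold X in *; lra).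
    rewrite G2_mid in Hret by (unfold X in *; lra). simpl in Hret.
    apply (int_eq _ 1) in Hret; [|unfold X in *; simpl; lra]. simpl in Hret. unfold X in *. lra. }
  rewrite (F2_axis_eq X (X - 1) 1) in Hret by (unfold X in *; lra).
  rewrite G2_steep in Hret by (unfold X in *; lra). simpl in Hret.
  apply (int_eq _ 1) in Hret; [|unfold X in *; simpl; lra]. simpl in Hret. unfold X in *. lra.
Qed.

Lemma F2_no_period_two : ~ Per F2 2.
Proof.
  pose proof (comb_L1 G2 B2 (- (7/16)) F2_data) as HF. fold F2 in HF.
  intros (z & Hz & _ & [k Hk] & Hmin). rewrite translate_add in Hk. unfold Nat.iter, nat_rect in Hk.
  assert (Hone : returns_mod1 F2 z 1 -> False).
  { intros H. specialize (Hmin 1%nat ltac:(lia) H). lia. }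
  destruct (Sspace_cases z Hz) as [E|[Hpos [m E]]].
  - pose proof (frac_range (fst z)) as Hs. set (s := frac (fst z)) in *.
    assert (Ez : z = translate (Int_part (fst z)) (s, 0)) by (rewrite E; unfold s, frac, translate; simpl; f_equal; lra).
    set (m := Int_part (fst z)) in *. clearbody m s. subst z.
    rewrite (F_shift F2 HF) in Hk by apply Sspace_axis.
    rewrite (F_shift F2 HF) in Hk by (apply F_S; [exact HF|apply Sspace_axis]).
    assert (Hk1 : fst (F2 (F2 (s, 0))) + IZR m = s + IZR m + IZR k) by exact (f_equal fst Hk).
    assert (Hk2 : snd (F2 (F2 (s, 0))) = 0) by exact (f_equal snd Hk).
    destruct (F2_double_return s Hs Hk2) as [H1 [q H2]]; [exists k; lra|].
    assert (EF : F2 (s, 0) = (s + IZR q, 0)).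
    { rewrite (surjective_pairing (F2 (s, 0))), H1. f_equal. lra. }
    apply Hone. exists q. rewrite translate_add. unroll. rewrite (F_shift F2 HF) by apply Sspace_axis.
    rewrite EF. unfold translate. simpl. f_equal. lra.
  - (* the branch lands on the part of the axis that climbs nothing *)
    assert (Ez : F2 z = (1 - 7/16 * snd z + IZR (m - 1), 0)).
    { rewrite E at 1. change (translate m (0, snd z)) with (0 + IZR m, snd z). rewrite Rplus_0_l.
      rewrite F2_stem, minus_IZR. f_equal. lra. }
    assert (Hsnd : snd (F2 (F2 z)) = 0).
    { rewrite Ez, F2_axis by lra. simpl. apply B2_flat. lra. }
    rewrite Hk in Hsnd. simpl in Hsnd. lra.
Qed.

Theorem theorem7 :
  (forall F : C -> C, L1 F ->
     (exists k : Z, Rtopology.interior (RotR F) (IZR k)) ->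
     same_set (Per F) posnat \/
     same_set (Per F) (posnat_minus 1) \/
     same_set (Per F) (posnat_minus 2)) /\
  (exists F0 F1 F2 : C -> C,
     (L1 F0 /\ L1 F1 /\ L1 F2) /\
     (Rtopology.interior (RotR F0) 0%R /\
      Rtopology.interior (RotR F1) 0%R /\
      Rtopology.interior (RotR F2) 0%R) /\
     same_set (Per F0) posnat /\
     same_set (Per F1) (posnat_minus 1) /\
     same_set (Per F2) (posnat_minus 2)).
Proof.
  split.
  - intros F HF [k Hk]. destruct (three_cases F k HF Hk) as (H0 & H1 & H2).
    destruct (classic (Per F 1)) as [P1|P1]; [|right; left; apply H1, P1].
    destruct (classic (Per F 2)) as [P2|P2]; [|right; right; apply H2, P2].
    left. apply H0; assumption.
  - pose proof (comb_L1 G0 B0 0 F0_data) as L0.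
    pose proof (comb_L1 G1 B1 (- (5/2)) F1_data) as L1'.
    pose proof (comb_L1 G2 B2 (- (7/16)) F2_data) as L2.
    exists F0, F1, F2. split; [split; [exact L0|split; [exact L1'|exact L2]]|].
    split; [split; [apply F0_interior|split; [apply F1_interior|apply F2_interior]]|].
    split; [|split].
    + apply (proj1 (three_cases F0 0 L0 F0_interior)); [apply F0_period_one|apply F0_period_two].
    + apply (proj1 (proj2 (three_cases F1 0 L1' F1_interior))), F1_no_period_one.
    + apply (proj2 (proj2 (three_cases F2 0 L2 F2_interior))), F2_no_period_two.
Qed.
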